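(* Let $N\ge4$, $h\ge0$ a half-integer and $\sigma\in\{-,+\}^N$; let $R=R_N$, $X=V(I_N)$ and $M=M_h^\sigma$. Then for every Zariski closed subset $Y\subset X$ of codimension $\ge2$, restriction from $X$ to $X-Y$ induces an isomorphism $M\cong\widetilde M(X-Y)$.
   Context: $k_i=\begin{pmatrix}a_i&b_i\\c_i&d_i\end{pmatrix}$, $Q_i=a_id_i-b_ic_i$, $I_N\subset\mathbb C[k_1,\dots,k_N]$ generated by the entries of $k_1+\dots+k_N$ and $Q_1,\dots,Q_N$; $R_N=\mathbb C[k]/I_N$, an integral domain, coordinate ring of $X$. For $k=\begin{pmatrix}a&b\\c&d\end{pmatrix}$ with $ad=bc$ in the ring, $S^{2h}k^+$ is the $(2h+1)\times(2h+1)$ matrix with $(i,j)$ entry ($0\le i,j\le 2h$) equal to $a^{2h-i-j}b^jc^i$ if $i+j\le2h$ and $b^{2h-i}c^{2h-j}d^{i+j-2h}$ if $i+j\ge2h$ (well defined modulo $ad-bc$), and $S^{2h}k^-$ is its transpose. $M_h^\sigma$ is the (graded, finitely generated) $R$-submodule of $R^{(2h+1)^N}$ given by the image of the Kronecker product $S^{2h}k_1^{\sigma_1}\otimes\cdots\otimes S^{2h}k_N^{\sigma_N}$. For a finitely generated $R$-module $M$, $\widetilde M$ is the associated coherent sheaf on $X$ with $\widetilde M(D_f)=M_f$ for $0\ne f\in R$, $D_f=\{f\ne0\}$; note $\widetilde M(X)=M$. *)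

(* Defs.v *)
From mathcomp Require Import all_boot all_algebra.
From mathcomp Require Import Rstruct.
From mathcomp Require Import complex.
From mathcomp Require Import mpoly.
Set Implicit Arguments. Unset Strict Implicit. Unset Printing Implicit Defensive.
Import GRing.Theory.
Local Open Scope ring_scope.

Definition CC : closedFieldType := complex Rdefinitions.R.

Section Defs.
Variable N : nat.

(* Polynomial ring C[k_1,...,k_N] in 4N variables; variable (t,e) is the
   e-th entry of k_t with e = 0,1,2,3 <-> a_t,b_t,c_t,d_t. *)
Definition Pol := {mpoly CC[N * 4]}.
Definition var (t : 'I_N) (e : 'I_4) : Pol := 'X_(mxvec_index t e).
Definition va t : Pol := var t 0.
Definition vb t : Pol := var t 1.
Definition vc t : Pol := var t 2.
Definition vd t : Pol := var t 3.

Definition sumgen (e : 'I_4) : Pol := \sum_(t < N) var t e.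
Definition Qgen (t : 'I_N) : Pol := va t * vd t - vb t * vc t.

Definition inI (p : Pol) : Prop :=
  exists (q1 : 'I_4 -> Pol) (q2 : 'I_N -> Pol),
    p = \sum_(e < 4) q1 e * sumgen e + \sum_(t < N) q2 t * Qgen t.

Definition point := 'I_(N * 4) -> CC.
Definition inX (x : point) : Prop :=
  (forall e, (sumgen e).@[x] = 0) /\ (forall t, (Qgen t).@[x] = 0).

Definition closedX (Y : point -> Prop) : Prop :=
  exists S : Pol -> Prop,
    forall x, Y x <-> (inX x /\ forall p, S p -> p.@[x] = 0).

Definition subsetP (A B : point -> Prop) := forall x, A x -> B x.
Definition psubsetP (A B : point -> Prop) :=
  subsetP A B /\ exists x, B x /\ ~ A x.

Definition irredX (Z : point -> Prop) : Prop :=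
  closedX Z /\ (exists x, Z x) /\
  forall Z1 Z2, closedX Z1 -> closedX Z2 ->
    (forall x, Z x -> Z1 x \/ Z2 x) -> subsetP Z Z1 \/ subsetP Z Z2.

(* codim(Y, X) >= 2 : every irreducible closed subset of Y (in particular
   every irreducible component) sits at the bottom of a chain
   Z < Z1 < Z2 of irreducible closed subsets of X of length 2. *)
Definition codim_ge2 (Y : point -> Prop) : Prop :=
  forall Z, irredX Z -> subsetP Z Y ->
    exists Z1 Z2, irredX Z1 /\ irredX Z2 /\ psubsetP Z Z1 /\ psubsetP Z1 Z2.

Definition Dopen (f : Pol) (x : point) : Prop := inX x /\ f.@[x] <> 0.

(* ---- the module M_h^sigma, with n2h = 2h ---- *)
Variable n2h : nat.
Definition idx := {ffun 'I_N -> 'I_n2h.+1}.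

Definition Splus (a b c d : Pol) (i j : 'I_n2h.+1) : Pol :=
  if (i + j <= n2h)%N then a ^+ (n2h - i - j) * b ^+ j * c ^+ i
  else b ^+ (n2h - i) * c ^+ (n2h - j) * d ^+ (i + j - n2h).

(* S^{2h} k^sigma ; sigma = true is +, false is - (transpose) *)
Definition Ssig (s : bool) (a b c d : Pol) (i j : 'I_n2h.+1) : Pol :=
  if s then Splus a b c d i j else Splus a b c d j i.

Definition Kron (sigma : 'I_N -> bool) (r c : idx) : Pol :=
  \prod_(t < N) Ssig (sigma t) (va t) (vb t) (vc t) (vd t) (r t) (c t).

(* An element of M is K v (mod I_N) for a vector v of polynomials. *)
Definition Kv sigma (v : idx -> Pol) (r : idx) : Pol :=
  \sum_(c : idx) Kron sigma r c * v c.

Definition eqM sigma (v v' : idx -> Pol) : Prop :=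
  forall r, inI (Kv sigma v r - Kv sigma v' r).

(* An element of M_f is represented by (v,k), meaning (K v)/f^k.
   Equality in M_f (M_f is a submodule of (R^n)_f since localisation is exact). *)
Definition eqMf sigma (f : Pol) (s s' : (idx -> Pol) * nat) : Prop :=
  exists j : nat, forall r,
    inI (f ^+ j * (f ^+ s'.2 * Kv sigma s.1 r - f ^+ s.2 * Kv sigma s'.1 r)).

(* restriction M_f -> M_g (for D_g subset D_f) sends s to something equal
   to s' in M_g:  (K v)/f^k = (K v')/g^k' in M_g *)
Definition res_eq sigma (f g : Pol) (s s' : (idx -> Pol) * nat) : Prop :=
  exists j : nat, forall r,
    inI (g ^+ j * (f ^+ s.2 * Kv sigma s'.1 r - g ^+ s'.2 * Kv sigma s.1 r)).

(* Sections of  M~  over an open U: compatible families (s_f in M_f) indexed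
   by the basic opens D_f contained in U (sheaf on the basis of D_f's). *)
Definition is_section sigma (U : point -> Prop)
    (s : Pol -> (idx -> Pol) * nat) : Prop :=
  forall f g, subsetP (Dopen f) U -> subsetP (Dopen g) U ->
    subsetP (Dopen g) (Dopen f) -> res_eq sigma f g (s f) (s g).

Definition eq_section sigma (U : point -> Prop) (s s' : Pol -> (idx -> Pol) * nat) :=
  forall f, subsetP (Dopen f) U -> eqMf sigma f (s f) (s' f).

Definition restr (v : idx -> Pol) : Pol -> (idx -> Pol) * nat := fun _ => (v, 0%N).

(* restriction M -> M~(U) is an isomorphism (it is R-linear; we state
   bijectivity: injective and surjective) *)
Definition restr_iso sigma (U : point -> Prop) : Prop :=
  (forall v v', eq_section sigma U (restr v) (restr v') -> eqM sigma v v') /\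
  (forall s, is_section sigma U s ->
     exists v, eq_section sigma U s (restr v)).

End Defs.

(* Main.v *)
Require Import Defs.
From HB Require Import structures.
From mathcomp Require Import all_boot all_algebra.
From mathcomp Require Import mpoly ssrcomplements.
From mathcomp Require Import ring zify.
From Stdlib Require Import Classical.

(** Writing each rank-one matrix as [k_t = v_t w_t^T] embeds [R] into the ring [C[v, w] / E], where
    [E] is generated by the four entries of [sum_t v_t w_t^T]; there [R] is the part of weight zero
    and [M_h^sigma] is the part of some other weight.  The entries of [sum_t v_t w_t^T] have, for
    suitable integral weights of the variables, pairwise coprime monomials as initial forms, also
    together with [v_{t,al}] and a minor [<i j>] of [v], or with the minors [<i j>] of [v] and [i j]
    of [w].  Hence all these are regular sequences, and solving the linear equations for [w_i],
    [w_j] where [<i j>] is invertible shows that [E] and [E + (v_{t,al})] are prime.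

    A section over [X - Y] is a fraction [m].  Where [prod_t a_t] and [a_i b_j - a_j b_i] are
    invertible, [X] is a principal open subset of an affine space, whose coordinate ring is
    factorial; a prime in the denominator of [m] would be a divisor of [X] contained in [Y], which
    is impossible in codimension 2.  So [m] is regular on this chart, as well as on the chart with
    [a] and [d] exchanged.  The two chart functions form a regular pair in [C[v, w] / E], so [m] lies
    in [C[v, w] / E], and its component of the right weight lies in [M]. *)

Set Implicit Arguments. Unset Strict Implicit. Unset Printing Implicit Defensive.
Import GRing.Theory.
Local Open Scope ring_scope.

(** * Factorial rings *)

(** The two charts do not cover [X - Y] in general; they are glued by depth two in the spinor ring
    and not by a covering. The exchange of [a] and [d] swaps the two kinds of spinors together with
    their components, so the two chart functions have no common factor. Ideals generated by [E] and
    one spinor variable are prime, which settles every pair of factors except that of the two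
    brackets; this pair has a weight table of its own. The bound [4 <= N] enters through the tables:
    the initial monomials must share no variable, and they are spread over four indices. Codimension
    is given by chains of closed sets, so one must exclude a chain of length two above a divisor. No
    dimension theory is needed: a descent on polynomial degrees in the chart suffices, with a
    Nullstellensatz for prime hypersurfaces only. A section takes values in vectors over [R], but
    all coordinates of such a vector are multiples of a single function of the spinors, so the
    extension problem concerns one fraction. *)

Section Factorial.
Variable D : idomainType.

Definition divides (a b : D) : Prop := exists c, b = a * c.

Definition prime_elt (p : D) : Prop :=
  [/\ p != 0, p \isn't a GRing.unit &
      forall a b, divides p (a * b) -> divides p a \/ divides p b].

Definition irred_elt (p : D) : Prop :=
  [/\ p != 0, p \isn't a GRing.unit &
      forall a b, p = a * b -> a \is a GRing.unit \/ b \is a GRing.unit].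

(** The additive [deg] replaces the ascending chain condition: nonunits have positive degree, so
    factorisation ends by induction on [deg]. *)
Definition factorial_by (deg : D -> nat) : Prop :=
  [/\ forall a b, a != 0 -> b != 0 -> deg (a * b) = (deg a + deg b)%N,
      forall a, a != 0 -> deg a = 0%N -> a \is a GRing.unit &
      forall p, irred_elt p -> prime_elt p].

Lemma dividesMl p a b : divides p a -> divides p (a * b).
Proof. by case=> c ->; exists (c * b); rewrite mulrA. Qed.

Lemma dividesMr p a b : divides p b -> divides p (a * b).
Proof. by rewrite mulrC; apply: dividesMl. Qed.

Lemma dividesD p a b : divides p a -> divides p b -> divides p (a + b).
Proof. by move=> [c ->] [d ->]; exists (c + d); rewrite mulrDr. Qed.

Lemma dividesBr p a b : divides p b -> divides p (a + b) -> divides p a.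
Proof.
by move=> [c ->] [d e]; exists (d - c); rewrite mulrBr -e addrK.
Qed.

Lemma divides0 p : divides p 0.
Proof. by exists 0; rewrite mulr0. Qed.

Lemma divides_expr p a k : prime_elt p -> divides p (a ^+ k) -> divides p a.
Proof.
move=> [p0 pu pP]; elim: k => [|k IHk]; rewrite ?expr0 ?exprS.
  by case=> c e; case/negP: pu; apply/unitrP; exists c; rewrite mulrC -e.
by case/pP.
Qed.

Variable deg : D -> nat.
Hypothesis facD : factorial_by deg.

Lemma ex_prime_divisor a : a != 0 -> a \isn't a GRing.unit ->
  exists2 p, prime_elt p & divides p a.
Proof.
have [degM deg0 irrP] := facD.
have [m le_m] := ubnP (deg a); elim: m a le_m => // m IHm a le_m a0 au.
have [/irrP pr|nirr] := classic (irred_elt a).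
  by exists a => //; exists 1; rewrite mulr1.
have [b [c [ebc bu cu]]] : exists b c,
    [/\ a = b * c, b \isn't a GRing.unit & c \isn't a GRing.unit].
  apply: NNPP => H; apply: nirr; split=> // b c e.
  case: (boolP (b \is a GRing.unit)) => [|bu]; first by left.
  case: (boolP (c \is a GRing.unit)) => [|cu]; first by right.
  by case: H; exists b, c.
move: a0; rewrite ebc mulf_eq0 negb_or => /andP[b0 c0].
have dc : (0 < deg c)%N.
  by rewrite lt0n; apply: contra cu => /eqP; apply: deg0.
have [|p pp dp] := IHm b _ b0 bu.
  by move: le_m; rewrite ebc degM //; lia.
by exists p => //; apply: dividesMl.
Qed.

Lemma factorial_ind (Q : D -> Prop) :
  (forall u, u \is a GRing.unit -> Q u) ->
  (forall p c, prime_elt p -> c != 0 -> Q c -> Q (p * c)) ->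
  forall a, a != 0 -> Q a.
Proof.
have [degM deg0 _] := facD.
move=> Qu Qp a; have [m le_m] := ubnP (deg a).
elim: m a le_m => // m IHm a le_m a0.
case: (boolP (a \is a GRing.unit)) => [/Qu //|au].
have [p pp [c e]] := ex_prime_divisor a0 au.
have [p0 pu _] := pp.
have c0 : c != 0 by apply: contraNneq a0 => c0; rewrite e c0 mulr0.
have dp : (0 < deg p)%N.
  by rewrite lt0n; apply: contra pu => /eqP; apply: deg0.
rewrite e; apply: Qp => //; apply: IHm => //.
by move: le_m; rewrite e degM //; lia.
Qed.

(** Removal of poles in codimension two, for the fraction [u / w]. The primes of [w] are treated one
    by one: a prime dividing [h] is absorbed by one more factor [h]; any other prime fails to divide
    some [s], hence divides [u] and cancels. *)
Lemma clear_denominator (h w u : D) (S : D -> Prop) :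
  w != 0 ->
  (forall p, prime_elt p -> ~ divides p h -> exists2 s, S s & ~ divides p s) ->
  (forall s, S s -> exists k, divides w ((s * h) ^+ k * u)) ->
  exists k, divides w (h ^+ k * u).
Proof.
move=> w0 HS; move: w w0 u; apply: factorial_ind => [w wu|p c pp c0 IH] u.
  by move=> _; exists 0%N; exists (w^-1 * u); rewrite expr0 mul1r mulrA divrr ?mul1r.
have [p0 _ pP] := pp.
move=> H; have [[b eb]|nph] := classic (divides p h).
  have [|k [d ed]] := IH u.
    move=> s /H[k [d ed]]; exists k.
    by exists (p * d); rewrite ed !mulrA [c * p]mulrC.
  by exists k.+1, (b * d); rewrite exprS -mulrA ed eb -!mulrA; congr (_ * _); rewrite mulrCA.
have [s Ss nps] := HS p pp nph.
have pu : divides p u.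
  have [k [d ed]] := H s Ss.
  have : divides p ((s * h) ^+ k * u) by rewrite ed; exists (c * d); rewrite mulrA.
  by case/pP => // /(divides_expr pp)/pP[].
case: pu => v ev; have [|k [d ed]] := IH v.
  move=> t /H[k [d ed]]; exists k, d; apply: (mulfI p0).
  by rewrite [RHS]mulrA -ed ev mulrCA.
by exists k, d; rewrite ev mulrCA ed mulrA.
Qed.

End Factorial.

(** * Gauss's theorem: polynomials over a factorial ring *)

Section FactorialPoly.
Variable D : idomainType.
Variable deg : D -> nat.
Hypothesis facD : factorial_by deg.

Lemma dividesC (c : D) (f : {poly D}) :
  divides c%:P f <-> forall i, divides c f`_i.
Proof.
split=> [[g ->] i|H]; first by exists g`_i; rewrite coefCM.
have [g Hg] : exists g : {poly D}, forall i, (i < size f)%N -> f`_i = c * g`_i.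
  have : forall n, exists g : {poly D}, forall i, (i < n)%N -> f`_i = c * g`_i.
    elim=> [|n [g Hg]]; first by exists 0.
    have [d ed] := H n.
    exists (\poly_(i < n.+1) if (i < n)%N then g`_i else d) => i lin.
    rewrite coef_poly lin; case: ifP => [/Hg //|].
    by move=> nlt; have -> : i = n by lia.
  exact.
exists (\poly_(i < size f) g`_i); apply/polyP => i.
rewrite coefCM coef_poly; case: ifP => [/Hg //|].
by rewrite ltnNge => /negbFE lef; rewrite mulr0 nth_default.
Qed.

Lemma prime_polyC (p : D) : prime_elt p -> prime_elt p%:P.
Proof.
move=> [p0 pu pP]; split; rewrite ?polyC_eq0 //.
  by rewrite poly_unitE size_polyC p0 coefC eqxx.
move=> f g; have [m] := ubnP (size f + size g)%N.
elim: m f g => // m IHm f g le_m dfg.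
have [->|f0] := eqVneq f 0; first by left; apply: divides0.
have [->|g0] := eqVneq g 0; first by right; apply: divides0.
have drop_lead (h : {poly D}) : h != 0 ->
    (size (h - lead_coef h *: 'X^((size h).-1))%R < size h)%N.
  move=> h0; have [n en] : exists n, size h = n.+1.
    by exists (size h).-1; rewrite prednK // lt0n size_poly_eq0.
  rewrite en /= ltnS; apply/leq_sizeP => j; rewrite leq_eqVlt.
  rewrite coefB coefZ coefXn /lead_coef.
  case/orP => [/eqP <-|lt]; first by rewrite en /= eqxx mulr1 subrr.
  by rewrite gtn_eqF // mulr0 subr0 nth_default // en.
have dlead (h : {poly D}) : divides p (lead_coef h) ->
    divides p%:P (lead_coef h *: 'X^((size h).-1)).
  by move=> [c ->]; exists (c *: 'X^((size h).-1)); rewrite mul_polyC scalerA.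
have : divides p (lead_coef f * lead_coef g).
  by rewrite -lead_coefM; apply: (proj1 (dividesC _ _)).
case/pP => /dlead dl.
- have := IHm (f - lead_coef f *: 'X^((size f).-1)) g; case.
  + by rewrite -ltnS; apply: leq_trans le_m; rewrite !ltnS ltn_add2r drop_lead.
  + apply: dividesBr (dividesMl g dl) _.
    by rewrite -mulrDl subrK.
  + by move=> H; left; have := dividesD H dl; rewrite subrK.
  + by right.
- have := IHm f (g - lead_coef g *: 'X^((size g).-1)); case.
  + by rewrite -ltnS; apply: leq_trans le_m; rewrite !ltnS ltn_add2l drop_lead.
  + apply: dividesBr (dividesMr f dl) _.
    by rewrite -mulrDr subrK.
  + by left.
  + by move=> H; right; have := dividesD H dl; rewrite subrK.
Qed.

Import Pdiv.CommonIdomain Pdiv.WeakIdomain.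

(* An irreducible polynomial of positive degree has no constant prime factor, so constants can be
   cancelled prime by prime. *)
Lemma irred_cancelC (f g k : {poly D}) (c : D) : irred_elt f -> (1 < size f)%N ->
  c != 0 -> c *: g = f * k -> divides f g.
Proof.
move=> [f0 fu fP] sf c0; move: c c0 g k.
apply: (factorial_ind facD) => [u uu|p c pp c0 IH] g k e.
  by exists (u^-1 *: k); rewrite -scalerAr -e scalerA mulVr // scale1r.
have [pC0 pCu pCP] := prime_polyC pp.
have : divides p%:P (f * k) by rewrite -e -scalerA -mul_polyC; exists (c *: g).
case/pCP => [[f1 ef]|[k1 ek]].
  case: (fP _ _ ef) => [|f1u]; first by rewrite (negPf pCu).
  move: sf; rewrite ef mul_polyC => sf.
  have := size_scale_leq p f1; move: f1u; rewrite poly_unitE => /andP[/eqP -> _].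
  by move: sf; case: (size _) => [|[]].
apply: (IH g k1); apply: (mulfI pC0).
by rewrite mul_polyC scalerA e ek; rewrite mulrCA.
Qed.

(** Irreducibility persists over the fraction field; [c] is the cleared denominator, and its primes
    cancel one by one from [g] or [k]. *)
Lemma irred_pseudo_factor (f g k : {poly D}) (c : D) : irred_elt f ->
  c != 0 -> c *: f = g * k -> (size g <= 1)%N \/ (size k <= 1)%N.
Proof.
move=> [f0 fu fP] c0; move: c c0 g k.
have unit1 (h : {poly D}) : h \is a GRing.unit -> (size h <= 1)%N.
  by rewrite poly_unitE => /andP[/eqP ->].
have szC (p : D) (h : {poly D}) : p != 0 -> size (p%:P * h) = size h.
  by move=> p0; rewrite mul_polyC size_scale.
apply: (factorial_ind facD) => [u uu|p c pp c0 IH] g k e.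
  case: (fP (u^-1 *: g) k).
  - by rewrite -scalerAl -e scalerA mulVr // scale1r.
  - move/unit1; rewrite size_scale; first by left.
    by apply: contraTneq uu => u0; rewrite -unitrV u0 unitr0.
  - by move/unit1; right.
have [pC0 pCu pCP] := prime_polyC pp.
have p0 : p != 0 by case: pp.
have : divides p%:P (g * k) by rewrite -e -scalerA -mul_polyC; exists (c *: f).
case/pCP => [[g1 eg]|[k1 ek]].
  case: (IH g1 k); last by right.
    by apply: (mulfI pC0); rewrite mul_polyC scalerA e eg mulrA.
  by rewrite eg szC //; left.
case: (IH g k1); first 1 last; first by left.
  by rewrite ek szC //; right.
by apply: (mulfI pC0); rewrite mul_polyC scalerA e ek mulrCA.
Qed.

Lemma irred_poly_prime (f : {poly D}) : irred_elt f -> prime_elt f.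
Proof.
move=> irr; have [f0 fu fP] := irr.
have [sf|sf] := leqP (size f) 1.
  have ef := size1_polyC sf; rewrite ef; apply: prime_polyC.
  have [_ _ irrP] := facD; apply: irrP.
  move: f0 fu; rewrite ef polyC_eq0 poly_unitE size_polyC => f0.
  rewrite f0 coefC eqxx /= => fu; split=> // a b eab.
  have := fP a%:P b%:P; rewrite ef eab polyCM => /(_ erefl).
  by rewrite !poly_unitE !coefC !eqxx => -[]/andP[_ ?]; [left|right].
split=> // g g' [k ek].
(* A constant gcd gives, by Bezout over the fraction field, a nonzero constant multiple of [g']
   divisible by [f]. Otherwise the gcd is [f] up to constants, and [f] divides [g]. *)
have [/eqP co|nco] := boolP (size (gcdp f g) == 1%N).
  right; have [[u v] /= uv] := Bezoutp f g.
  have [a a0 eg] : exists2 a, a != 0 & gcdp f g = a%:P.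
    exists (gcdp f g)`_0; last by apply: size1_polyC; rewrite co.
    rewrite -polyC_eq0 -size1_polyC ?co //.
    by rewrite -size_poly_eq0 co.
  move: uv; rewrite eg => /eqpP[[c1 c2] /= /andP[c10 c20] euv].
  apply: (@irred_cancelC f g' (c1 *: (u * g') + c1 *: (v * k)) (c2 * a)) => //.
    by rewrite mulf_neq0.
  have -> : (c2 * a) *: g' = (c2 *: a%:P) * g'.
    by rewrite -mul_polyC polyCM -mul_polyC.
  rewrite -euv -scalerAl mulrDl -scalerDr -scalerAr mulrDr; congr (_ *: (_ + _)).
    by rewrite mulrC mulrA [g' * u]mulrC mulrC.
  by rewrite -mulrA ek mulrCA.
left; have d0 : gcdp f g != 0 by rewrite gcdp_eq0 (negPf f0).
have /dvdpP[[c q] /= c0 ec] := dvdp_gcdl f g.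
have /dvdpP[[c' q'] /= c'0 ec'] := dvdp_gcdr f g.
case: (irred_pseudo_factor irr c0 ec) => [sq|]; last first.
  by move: nco; rewrite -size_poly_eq0 in d0; move: d0; case: (size _) => [|[]].
have [a ea] : exists a, q = a%:P by exists q`_0; apply: size1_polyC.
have a0 : a != 0.
  apply: contraNneq f0 => a0; move/eqP: ec.
  by rewrite ea a0 mul0r -mul_polyC mulf_eq0 polyC_eq0 (negPf c0).
apply: (@irred_cancelC f g (c *: q') (a * c')) => //; first by rewrite mulf_neq0.
by rewrite -scalerA ec' -[a *: _]mul_polyC -ea mulrCA -ec -!scalerAr mulrC.
Qed.

Lemma factorial_poly :
  factorial_by (fun f : {poly D} => ((size f).-1 + deg (lead_coef f))%N).
Proof.
have [degM deg0 _] := facD; split; last exact: irred_poly_prime.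
- move=> f g f0 g0; rewrite lead_coefM degM ?lead_coef_eq0 // size_mul //.
  have : (0 < size f)%N by rewrite lt0n size_poly_eq0.
  have : (0 < size g)%N by rewrite lt0n size_poly_eq0.
  lia.
- move=> f f0 /eqP; rewrite addn_eq0 => /andP[/eqP s0 /eqP d0].
  have s1 : size f = 1%N.
    by move: s0 f0; rewrite -size_poly_eq0; case: (size f) => [|[]].
  rewrite poly_unitE s1 eqxx /=.
  by move: d0; rewrite /lead_coef s1 => /deg0 -> //; move: f0;
     rewrite -lead_coef_eq0 /lead_coef s1.
Qed.

End FactorialPoly.

(** * Polynomial rings over an algebraically closed field *)

Lemma mpoly_alg_ind (n : nat) (R : comNzRingType) (Q : {mpoly R[n]} -> Prop) :
  (forall c, Q c%:MP) -> (forall i, Q 'X_i) ->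
  (forall p q, Q p -> Q q -> Q (p + q)) ->
  (forall p q, Q p -> Q q -> Q (p * q)) -> forall p, Q p.
Proof.
move=> QC QX QD QM; have Q0 : Q 0 by rewrite -mpolyC0.
have Q1 : Q 1 by rewrite -mpolyC1.
elim/mpolyind => // c m p _ _ Qp; apply: QD => //.
rewrite -mul_mpolyC; apply: (QM) => //; rewrite mpolyXE_id.
apply: (big_ind Q) => // i _; elim: (m i) => [|k IH]; rewrite ?expr0 //.
by rewrite exprS; apply: QM.
Qed.

Lemma mpoly_rmorph_ext (n : nat) (R : comNzRingType) (S : nzRingType)
    (f g : {rmorphism {mpoly R[n]} -> S}) :
  (forall c, f c%:MP = g c%:MP) -> (forall i, f 'X_i = g 'X_i) -> f =1 g.
Proof.
move=> eC eX; apply: mpoly_alg_ind => // p q ep eq; first by rewrite !rmorphD ep eq.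
by rewrite !rmorphM ep eq.
Qed.

(** * Polynomials in [n.+1] variables as univariate polynomials in the last variable *)

Section Univariate.
Variables (K : idomainType) (n : nat).

Definition lastvar (i : 'I_n.+1) : {poly {mpoly K[n]}} :=
  if unlift ord_max i is Some j then ('X_j)%:P else 'X.

Definition to_uni : {mpoly K[n.+1]} -> {poly {mpoly K[n]}} :=
  mmap (polyC \o @mpolyC n K) lastvar.

HB.instance Definition _ := GRing.RMorphism.on to_uni.

Definition raise : {mpoly K[n]} -> {mpoly K[n.+1]} :=
  mmap (@mpolyC n.+1 K) (fun j => 'X_(lift ord_max j)).

HB.instance Definition _ := GRing.RMorphism.on raise.

Definition of_uni : {poly {mpoly K[n]}} -> {mpoly K[n.+1]} :=
  horner_eval 'X_ord_max \o map_poly raise.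

HB.instance Definition _ := GRing.RMorphism.on of_uni.

Lemma to_uniC c : to_uni c%:MP = (c%:MP)%:P.
Proof. exact: mmapC. Qed.

Lemma to_uniX i : to_uni 'X_i = lastvar i.
Proof. by rewrite /to_uni mmapX mmap1U. Qed.

Lemma raiseC c : raise c%:MP = c%:MP.
Proof. exact: mmapC. Qed.

Lemma raiseX i : raise 'X_i = 'X_(lift ord_max i).
Proof. by rewrite /raise mmapX mmap1U. Qed.

Lemma of_uniC p : of_uni p%:P = raise p.
Proof. by rewrite /of_uni /= map_polyC /= /horner_eval hornerC. Qed.

Lemma of_uniX : of_uni 'X = 'X_ord_max.
Proof. by rewrite /of_uni /= map_polyX /= /horner_eval hornerX. Qed.

Lemma to_uniK : cancel to_uni of_uni.
Proof.
apply: (mpoly_rmorph_ext (f := of_uni \o to_uni) (g := idfun)) => [c|i] /=.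
  by rewrite to_uniC of_uniC raiseC.
rewrite to_uniX /lastvar; case: unliftP => [j|] ->; last exact: of_uniX.
by rewrite of_uniC raiseX.
Qed.

Lemma to_uni_raise p : to_uni (raise p) = p%:P.
Proof.
apply: (mpoly_rmorph_ext (f := to_uni \o raise) (g := polyC)) => [c|i] /=.
  by rewrite raiseC to_uniC.
by rewrite raiseX to_uniX /lastvar liftK.
Qed.

Lemma of_uniK : cancel of_uni to_uni.
Proof.
elim/poly_ind => [|p c IH]; first by rewrite !rmorph0.
rewrite rmorphD rmorphM /= of_uniX of_uniC rmorphD rmorphM /= IH to_uni_raise.
by rewrite to_uniX /lastvar unlift_none.
Qed.

Lemma meval_to_uni (x : 'I_n.+1 -> K) p :
  p.@[x] = (map_poly (meval (x \o lift ord_max)) (to_uni p)).[x ord_max].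
Proof.
apply: (mpoly_rmorph_ext (f := meval x)
  (g := horner_eval (x ord_max) \o map_poly (meval (x \o lift ord_max)) \o to_uni)).
  by move=> c /=; rewrite mevalC to_uniC map_polyC /= mevalC /horner_eval hornerC.
move=> i /=; rewrite to_uniX /lastvar mevalXU /horner_eval.
case: unliftP => [j|] ->; first by rewrite map_polyC /= mevalXU hornerC.
by rewrite map_polyX hornerX.
Qed.

End Univariate.

Section Transport.
Variables (D D' : idomainType) (f : {rmorphism D -> D'}) (g : {rmorphism D' -> D}).
Hypotheses (fK : cancel f g) (gK : cancel g f).

Lemma divides_iso a b : divides a b <-> divides (f a) (f b).
Proof.
split=> [[c ->]|[c e]]; first by exists (f c); rewrite rmorphM.
by exists (g c); rewrite -[a]fK -rmorphM -e fK.
Qed.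

Lemma unit_iso a : (f a \is a GRing.unit) = (a \is a GRing.unit).
Proof.
apply/idP/idP; last exact: rmorph_unit.
by move/(rmorph_unit g); rewrite fK.
Qed.

Lemma eq0_iso a : (f a == 0) = (a == 0).
Proof. by rewrite -(inj_eq (can_inj fK)) rmorph0. Qed.

Lemma prime_iso p : prime_elt p <-> prime_elt (f p).
Proof.
split=> -[p0 pu pP]; split; rewrite ?unit_iso ?eq0_iso //.
- move=> a b; rewrite -[a]gK -[b]gK -rmorphM -!divides_iso; exact: pP.
- by move: p0; rewrite eq0_iso.
- by move: pu; rewrite unit_iso.
- by move=> a b; rewrite !divides_iso rmorphM; apply: pP.
Qed.

Lemma irred_iso p : irred_elt p -> irred_elt (f p).
Proof.
move=> [p0 pu pP]; split; rewrite ?unit_iso ?eq0_iso // => a b e.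
have := pP (g a) (g b); rewrite -rmorphM -e fK => /(_ erefl).
by rewrite -2!unit_iso !gK.
Qed.

Lemma factorial_iso deg : factorial_by deg -> factorial_by (deg \o f).
Proof.
move=> [degM deg0 irrP]; split=> [a b a0 b0|a a0|p irr] /=.
- by rewrite rmorphM degM // eq0_iso.
- by rewrite -eq0_iso in a0 => /(deg0 _ a0); rewrite unit_iso.
- by apply/prime_iso/irrP/irred_iso.
Qed.
End Transport.

Section FieldCoef.
Variable K : closedFieldType.

Lemma mpoly_factorial n : exists deg : {mpoly K[n]} -> nat, factorial_by deg.
Proof.
elim: n => [|n [deg facn]].
  exists (fun=> 0%N).
  have u (a : {mpoly K[0]}) : a != 0 -> a \is a GRing.unit.
    rewrite [a]nvar0_mpolyC mpolyC_eq0 => a0; apply: rmorph_unit.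
    by rewrite unitfE.
  by split=> // [a /u //|p [/u ->]].
eexists; exact: (@factorial_iso _ _ (@to_uni K n) (@of_uni K n) (@to_uniK K n) (@of_uniK K n) _
  (factorial_poly facn)).
Qed.

Lemma mpoly_nonroot n (p : {mpoly K[n]}) : p != 0 -> exists x, p.@[x] != 0.
Proof.
elim: n p => [|n IH] p p0.
  exists (fun=> 0); move: p0; rewrite [p]nvar0_mpolyC mpolyC_eq0.
  by rewrite mevalC.
have q0 : to_uni p != 0 by rewrite (eq0_iso (@to_uniK K n)).
have [|x lx] := IH (lead_coef (to_uni p)); first by rewrite lead_coef_eq0.
have [|t tP] := closed_nonrootP (map_poly (meval x) (to_uni p)) _.
  apply: contraNneq lx => /(congr1 (fun r : {poly K} => r`_(size (to_uni p)).-1)).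
  by rewrite coef_map coef0 /= => ->.
exists (fun i => if unlift ord_max i is Some j then x j else t).
rewrite meval_to_uni unlift_none.
by rewrite (eq_map_poly (g := meval x)) // => q; apply: meval_eq => i /=; rewrite liftK.
Qed.

Lemma mpoly_eq0_eval n (p : {mpoly K[n]}) : (forall x, p.@[x] = 0) -> p = 0.
Proof.
move=> H; apply/eqP; apply: contraT => /mpoly_nonroot[x].
by rewrite H eqxx.
Qed.

Import Pdiv.CommonIdomain Pdiv.WeakIdomain.

Lemma size_polyC_factors (D : idomainType) (p q : {poly D}) (c : D) :
  c != 0 -> c%:P = p * q -> (size p <= 1)%N /\ (size q <= 1)%N.
Proof.
move=> c0 e; have : p * q != 0 by rewrite -e polyC_eq0.
rewrite mulf_eq0 negb_or => /andP[p0 q0].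
have := size_mul p0 q0; rewrite -e size_polyC c0.
move: p0 q0; rewrite -!size_poly_eq0 -!lt0n; lia.
Qed.

(** A substitute for the resultant: primality of [p] forces its gcd with [g] over the fraction field
    to be constant, and Bezout's identity with cleared denominators gives [c]. *)
Lemma prime_coprime_const (D : idomainType) (p g : {poly D}) :
  prime_elt p -> (1 < size p)%N -> ~ divides p g ->
  exists u v (c : D), c != 0 /\ u * p + v * g = c%:P.
Proof.
move=> [p0 pu pP] sp npg.
have ndC (c : D) : c != 0 -> ~ divides p c%:P.
  by move=> c0 [q /(size_polyC_factors c0)[]]; rewrite leqNgt sp.
have cancelC (c : D) (q : {poly D}) : c != 0 -> divides p (c *: q) -> divides p q.
  by move=> c0; rewrite -mul_polyC => /pP[/(ndC _ c0)|].
have [d ed] : exists d, d = gcdp p g by eexists.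
have d0 : d != 0 by rewrite ed gcdp_eq0 (negPf p0).
have /dvdpP[[c q] /= c0 ec] : d %| p by rewrite ed dvdp_gcdl.
have /dvdpP[[c' q'] /= c'0 ec'] : d %| g by rewrite ed dvdp_gcdr.
have [[u v] /= ] := Bezoutp p g; rewrite -ed => /eqpP[[c1 c2] /= /andP[c10 c20] e].
have npd : ~ divides p d.
  by move=> dd; apply: npg; apply: (cancelC _ _ c'0); rewrite ec'; apply: dividesMr.
have : divides p (q * d) by rewrite -ec -mul_polyC; apply: dividesMr; exists 1; rewrite mulr1.
case/pP => // -[r er].
have sd : size d = 1%N.
  have : c%:P = r * d by apply: (mulfI p0); rewrite mulrA -er -ec -mul_polyC mulrC.
  move/(size_polyC_factors c0) => [_ s1]; apply/eqP.
  by rewrite eqn_leq s1 lt0n size_poly_eq0.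
have eC := size1_polyC (eq_leq sd).
exists (c1 *: u), (c1 *: v), (c2 * d`_0); split.
  by rewrite mulf_neq0 // -polyC_eq0 -eC.
by rewrite polyCM -eC mul_polyC -e scalerDr !scalerAl.
Qed.

(** Induction on the number of variables. If [p] has positive degree in the last variable and does
    not divide [g], a combination of both is a nonzero polynomial [c] in the other variables. Over a
    point where [c] and the leading coefficient of [p] do not vanish, [p] still has a root, and [g]
    cannot vanish there. *)
Lemma hypersurface_nullstellensatz n (p g : {mpoly K[n]}) : prime_elt p ->
  (forall x, p.@[x] = 0 -> g.@[x] = 0) -> divides p g.
Proof.
elim: n p g => [|n IH] p g pp Hg.
  have [p0 pu _] := pp; case/negP: pu; move: p0.
  rewrite [p]nvar0_mpolyC mpolyC_eq0 => p0; apply: rmorph_unit.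
  by rewrite unitfE.
have tK := @to_uniK K n; have oK := @of_uniK K n.
move/(prime_iso tK oK): pp; suff : prime_elt (to_uni p) -> divides (to_uni p) (to_uni g)
  by move=> H /H/(divides_iso tK).
set q := to_uni p; set r := to_uni g => pq.
pose ext (y : 'I_n -> K) t := fun i => if unlift ord_max i is Some j then y j else t.
have evE (f : {mpoly K[n.+1]}) y t :
    f.@[ext y t] = (map_poly (meval y) (to_uni f)).[t].
  rewrite meval_to_uni /ext unlift_none (eq_map_poly (g := meval y)) // => h.
  by apply: meval_eq => i /=; rewrite liftK.
have {}Hg y t : (map_poly (meval y) q).[t] = 0 -> (map_poly (meval y) r).[t] = 0.
  by move=> H; have := Hg (ext y t); rewrite (evE p) (evE g); apply.
clearbody q r.
have [sq|sq] := leqP (size q) 1.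
  have eq := size1_polyC sq; move: pq; rewrite eq; set c := q`_0 => pC.
  have pc : prime_elt c.
    have [c0 cu cP] := pC; split; first by rewrite polyC_eq0 in c0.
      by move: cu; rewrite poly_unitE coefC eqxx size_polyC -polyC_eq0 c0.
    move=> a b; have := cP a%:P b%:P; rewrite -polyCM !dividesC => H [d ed].
    case: H => [i|/(_ 0%N)|/(_ 0%N)]; rewrite coefC ?eqxx.
    - by case: eqP => _; [exists d | apply: divides0].
    - by left.
    - by right.
  (* Here [p] does not involve the last variable. Over a zero [y] of [p] the specialised [g] has
     every scalar as a root, so all its coefficients vanish. *)
  apply/dividesC => i; apply: IH => // y cy.
  have : map_poly (meval y) r = 0.
    apply/eqP; apply: contraT => /closed_nonrootP[t]; rewrite rootE Hg ?eqxx //.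
    by rewrite eq map_polyC /= cy horner0.
  by move/(congr1 (fun s : {poly K} => s`_i)); rewrite coef_map coef0.
apply: NNPP => nd; have [u [v [c [c0 e]]]] := prime_coprime_const pq sq nd.
have l0 : lead_coef q != 0 by case: pq => q0 _ _; rewrite lead_coef_eq0.
have [y] := mpoly_nonroot (mulf_neq0 c0 l0).
rewrite mevalM mulf_eq0 negb_or => /andP[cy ly].
have sy : size (map_poly (meval y) q) != 1%N.
  by rewrite size_map_poly_id0 // neq_ltn sq orbT.
have /closed_rootP[t] := sy; rewrite rootE => /eqP qt.
pose ev := (horner_eval t \o map_poly (meval y) : {rmorphism {poly {mpoly K[n]}} -> K}).
have := congr1 ev e; rewrite (rmorphD ev) (rmorphM ev u) (rmorphM ev v).
have -> : ev q = 0 by [].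
have -> : ev r = 0 by exact: Hg.
have -> : ev c%:P = c.@[y] by rewrite /ev /= map_polyC /horner_eval hornerC.
by rewrite !mulr0 addr0 => /esym/eqP; rewrite (negPf cy).
Qed.

Lemma prime_XsubC n (i : 'I_n) (c : K) : prime_elt ('X_i - c%:MP : {mpoly K[n]}).
Proof.
have [deg [degM deg0 irrP]] := mpoly_factorial n; apply: irrP.
have szX : msize ('X_i - c%:MP : {mpoly K[n]}) = 2%N.
  apply/eqP; rewrite eqn_leq; apply/andP; split.
    apply: leq_trans (mmeasureD_le _ _ _) _; rewrite geq_max mmeasureN msizeX mdeg1 /=.
    by rewrite mmeasureC; case: eqP.
  rewrite -[leqLHS]/(1.+1) -(mdeg1 i); apply: msize_mdeg_lt.
  rewrite mcoeff_msupp mcoeffB mcoeffX eqxx mcoeffC.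
  suff -> : (U_(i)%MM == 0%MM) = false by rewrite mulr0 subr0 oner_neq0.
  by apply/eqP => /(congr1 (@mdeg n)); rewrite mdeg1 mdeg0.
have unit1 (a : {mpoly K[n]}) : (msize a == 1%N) -> a \is a GRing.unit.
  by case/msize_poly1P => d d0 ->; apply: rmorph_unit; rewrite unitfE.
have p0 : 'X_i - c%:MP != 0 :> {mpoly K[n]}.
  by rewrite -(mmeasure_poly_eq0 mdeg) szX.
split=> // [|a b e].
  apply/negP => /unitrP[b [e _]].
  have b0 : b != 0 by apply: contra_eq_neq e => ->; rewrite mul0r eq_sym oner_neq0.
  have := msizeM b0 p0; rewrite e msize1 szX.
  by move: b0; rewrite -(mmeasure_poly_eq0 mdeg); case: (msize b) => // s; rewrite addn2.
have : a * b != 0 by rewrite -e.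
rewrite mulf_eq0 negb_or => /andP[a0 b0].
have := msizeM a0 b0; rewrite -e szX.
move: a0 b0; rewrite -!(mmeasure_poly_eq0 mdeg) => a0 b0 es.
suff : (msize a == 1%N) || (msize b == 1%N) by case/orP => /unit1; [left|right].
by move: a0 b0 es; case: (msize a) => [|[|s]] //; case: (msize b) => [|[|t]] //; rewrite !addSn !addnS.
Qed.

End FieldCoef.

(** * Ideals and initial forms *)

Section Ideal.
Variable R : comNzRingType.
Implicit Types (gs : seq R) (p q : R).

(** Peeling off the head makes membership in [g :: gs] membership in [gs] up to a multiple of [g],
    the form in which regular sequences are used. *)
Fixpoint ideal gs p : Prop :=
  if gs is g :: gs' then exists a, ideal gs' (p - a * g) else p = 0.

Lemma ideal_zero gs : ideal gs 0.
Proof. by elim: gs => //= g gs IH; exists 0; rewrite mul0r subr0. Qed.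

Lemma ideal_add gs p q : ideal gs p -> ideal gs q -> ideal gs (p + q).
Proof.
elim: gs p q => /= [p q -> ->|g gs IH p q [a Ha] [b Hb]]; first by rewrite addr0.
by exists (a + b); rewrite mulrDl opprD addrACA; apply: IH.
Qed.

Lemma ideal_mull gs a p : ideal gs p -> ideal gs (a * p).
Proof.
elim: gs p => /= [p ->|g gs IH p [b Hb]]; first by rewrite mulr0.
by exists (a * b); rewrite -mulrA -mulrBr; apply: IH.
Qed.

Lemma ideal_mulr gs a p : ideal gs p -> ideal gs (p * a).
Proof. by rewrite mulrC; apply: ideal_mull. Qed.

Lemma ideal_opp gs p : ideal gs p -> ideal gs (- p).
Proof. by rewrite -mulN1r; apply: ideal_mull. Qed.

Lemma ideal_subr gs p q : ideal gs p -> ideal gs q -> ideal gs (p - q).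
Proof. by move=> Hp /ideal_opp; apply: ideal_add. Qed.

Lemma ideal_cons g gs p : ideal gs p -> ideal (g :: gs) p.
Proof. by exists 0; rewrite mul0r subr0. Qed.

Lemma ideal_mem gs g : g \in gs -> ideal gs g.
Proof.
elim: gs => // h gs IH; rewrite inE => /predU1P[->|/IH]; last exact: ideal_cons.
by exists 1; rewrite mul1r subrr; apply: ideal_zero.
Qed.

Lemma ideal_incl gs gs' p :
  (forall g, g \in gs -> ideal gs' g) -> ideal gs p -> ideal gs' p.
Proof.
elim: gs p => /= [p _ ->|g gs IH p Hs [a Ha]]; first exact: ideal_zero.
rewrite -[p](subrK (a * g)); apply: ideal_add.
  by apply: IH Ha => h hg; apply: Hs; rewrite inE hg orbT.
by apply: ideal_mull; apply: Hs; rewrite inE eqxx.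
Qed.

Lemma ideal_sum gs (I : Type) (r : seq I) (P : pred I) F :
  (forall i, P i -> ideal gs (F i)) -> ideal gs (\sum_(i <- r | P i) F i).
Proof. by move=> H; apply: (big_ind (ideal gs)) => //; [apply: ideal_zero|apply: ideal_add]. Qed.

End Ideal.

(** * Regular sequences from coprime initial monomials *)

Section InitialForms.
Variables (K : fieldType) (n : nat) (wt : 'I_n -> nat).
Local Notation P := {mpoly K[n]}.
Implicit Types (m mu : 'X_{1..n}) (p q b g : P) (G : seq ('X_{1..n} * P)).

Definition weight m : nat := \sum_(i < n) m i * wt i.

Lemma weightD m1 m2 : weight (m1 + m2)%MM = (weight m1 + weight m2)%N.
Proof. by rewrite -big_split; apply: eq_bigr => i _; rewrite mnmDE mulnDl. Qed.

Definition weight_lt d p : Prop := forall m, p@_m != 0 -> (weight m < d)%N.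

Lemma weight_ltE d p m : weight_lt d p -> (d <= weight m)%N -> p@_m = 0.
Proof. by move=> H le; apply/eqP; apply: contraLR le => /H; rewrite -ltnNge. Qed.

Lemma weight_ltD d p q : weight_lt d p -> weight_lt d q -> weight_lt d (p + q).
Proof.
move=> Hp Hq m; apply: contraR; rewrite -leqNgt => le.
by rewrite mcoeffD (weight_ltE Hp) // (weight_ltE Hq) // addr0.
Qed.

Lemma weight_ltN d p : weight_lt d p -> weight_lt d (- p).
Proof. by move=> Hp m; rewrite mcoeffN oppr_eq0; apply: Hp. Qed.

Lemma weight_lt0 d : weight_lt d 0.
Proof. by move=> m; rewrite mcoeff0 eqxx. Qed.

Lemma weight_ltW d e p : (d <= e)%N -> weight_lt d p -> weight_lt e p.
Proof. by move=> le Hp m /Hp lt; apply: leq_trans le. Qed.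

Lemma weight_ltM d e p q :
  weight_lt d.+1 p -> weight_lt e q -> weight_lt (d + e) (p * q).
Proof.
move=> Hp Hq m; rewrite -mcoeff_msupp => /msuppM_le/allpairsP[[m1 m2] /= [mp mq ->]].
rewrite !mcoeff_msupp in mp mq; rewrite weightD.
by have := Hp _ mp; have := Hq _ mq; lia.
Qed.

Lemma weight_lt_ex p : exists d, weight_lt d p.
Proof.
exists (\max_(m <- msupp p) (weight m).+1)%N => m; rewrite -mcoeff_msupp => mp.
exact: (@leq_bigmax_seq _ (msupp p) xpredT (fun m => (weight m).+1)).
Qed.

Definition has_initial (x : 'X_{1..n} * P) : Prop :=
  weight_lt (weight x.1) (x.2 - 'X_[x.1]).

Definition coprime_mnm m1 m2 : bool := [forall i, (m1 i == 0%N) || (m2 i == 0%N)].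

Definition in_monomials G m : bool := has (fun x => x.1 <= m)%MM G.

(** A Groebner basis property for the order by weight: top forms of elements of the ideal lie in the
    monomial ideal of the initial monomials. As [d] is only a bound, the condition is empty when [p]
    has smaller weight. *)
Definition initials_in G : Prop := forall p d, ideal (map snd G) p ->
  weight_lt d.+1 p -> forall m, p@_m != 0 -> weight m = d -> in_monomials G m.

Lemma in_monomials_coprime G mu m :
  all (fun x => coprime_mnm x.1 mu) G -> in_monomials G (m + mu)%MM -> in_monomials G m.
Proof.
move=> /allP co /hasP[x xG /mnm_lepP le]; apply/hasP; exists x => //.
apply/mnm_lepP => i; have := le i; have /forallP/(_ i) := co x xG.
by rewrite mnmDE; case/orP => /eqP ->; rewrite ?addn0.
Qed.

(** A division step: each top term is a multiple of an initial monomial, and is replaced by the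
    lower terms of that generator. *)
Lemma reduce_top G p d : (forall x, x \in G -> has_initial x) -> weight_lt d.+1 p ->
  (forall m, p@_m != 0 -> weight m = d -> in_monomials G m) ->
  exists2 p', weight_lt d p' & ideal (map snd G) (p - p').
Proof.
move=> Gi Hp Hm.
suff [p' Hp' Hi] : exists2 p', weight_lt d p' &
    ideal (map snd G) (\sum_(m <- msupp p) p@_m *: 'X_[m] - p').
  by exists p'; rewrite // -mpolyE in Hi.
have : {subset msupp p <= msupp p} by [].
elim: {1 3}(msupp p) => [|m s IH] sub.
  by exists 0; [apply: weight_lt0|rewrite big_nil subr0; apply: ideal_zero].
have [t Ht It] : exists2 t, weight_lt d t & ideal (map snd G) (p@_m *: 'X_[m] - t).
  have mp : p@_m != 0 by rewrite -mcoeff_msupp sub // mem_head.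
  have [lt|] := ltnP (weight m) d.
    exists (p@_m *: 'X_[m]); last by rewrite subrr; apply: ideal_zero.
    move=> m'; rewrite mcoeffZ mcoeffX; case: (m =P m') => [<- //|_].
    by rewrite mulr0 eqxx.
  move=> le; have ew : weight m = d by have := Hp _ mp; lia.
  have /hasP[[mu g] xG /= le_mu] := Hm m mp ew.
  exists (- (p@_m *: ('X_[m - mu] * (g - 'X_[mu])))).
    apply: weight_ltN => m'; rewrite mcoeffZ mulf_eq0 negb_or mp /=.
    rewrite mulrC mcoeffM => H.
    have {H} : ('X_[m - mu] * (g - 'X_[mu]))@_m' != 0 by rewrite mulrC mcoeffM.
    have HX : weight_lt (weight (m - mu)%MM).+1 ('X_[m - mu] : P).
      by move=> k; rewrite mcoeffX; case: (_ =P k) => [-> //|_]; rewrite eqxx.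
    move/(weight_ltM HX (Gi _ xG)); rewrite /= -weightD submK //.
    by rewrite ew.
  rewrite opprK -scalerDr mulrBr -mpolyXD submK // addrC subrK.
  by rewrite scalerAl; apply/ideal_mull/ideal_mem/mapP; exists (mu, g).
have [|p' Hp' Ip'] := IH; first by move=> k ks; apply: sub; rewrite inE ks orbT.
exists (t + p'); first exact: weight_ltD.
by rewrite big_cons opprD addrACA; apply: ideal_add.
Qed.

Section Step.
Variables (G : seq ('X_{1..n} * P)) (mu : 'X_{1..n}) (g : P).
Hypotheses (Gi : forall x, x \in G -> has_initial x) (AG : initials_in G).
Hypotheses (gi : has_initial (mu, g)) (co : all (fun x => coprime_mnm x.1 mu) G).

Lemma mcoeff_top e b m : weight_lt e.+1 b -> (e <= weight m)%N ->
  (b * g)@_(m + mu) = b@_m.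
Proof.
move=> Hb em; rewrite -[g](subrK 'X_[mu]) mulrDr mcoeffD [(m + mu)%MM]addmC mcoeffMX.
rewrite (weight_ltE (weight_ltM Hb gi)) ?add0r // addmC weightD leq_add2r.
exact: em.
Qed.

Lemma top_in_monomials e b q c : weight_lt e.+1 b -> ideal (map snd G) q -> c != 0 ->
  weight_lt (e + weight mu).+1 q ->
  (forall m, weight m = e -> q@_(m + mu) = c * b@_m) ->
  forall m, b@_m != 0 -> weight m = e -> in_monomials G m.
Proof.
move=> Hb Iq c0 Hq eq m bm em; apply: (in_monomials_coprime co).
by apply: (AG Iq Hq); rewrite ?weightD ?em // eq // mulf_neq0.
Qed.

Lemma weight_ltMg e b : weight_lt e.+1 b -> weight_lt (e + weight mu).+1 (b * g).
Proof.
move=> Hb; rewrite -[g](subrK 'X_[mu]) mulrDr; apply: weight_ltD.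
  by apply: weight_ltW (weight_ltM Hb gi) => //=.
rewrite -addnS; apply: weight_ltM => // m; rewrite mcoeffX; case: (_ =P m) => [-> //|_].
by rewrite eqxx.
Qed.

(** Multiplication by [g] shifts the top monomials of [p] by [mu]. Since [mu] shares no variable
    with the other initial monomials, the top of [p] is itself reducible, and reduction lowers the
    weight. *)
Lemma initial_regular p : ideal (map snd G) (p * g) -> ideal (map snd G) p.
Proof.
have [d] := weight_lt_ex p; elim: d p => [|d IH] p Hp Ip.
  suff -> : p = 0 by apply: ideal_zero.
  by apply/mpolyP => m; rewrite mcoeff0 (weight_ltE Hp).
have [] := @reduce_top G p d Gi Hp.
  apply: (top_in_monomials Hp Ip (oner_neq0 K)); first exact: weight_ltMg.
  by move=> m em; rewrite (mcoeff_top Hp) ?em // mul1r.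
move=> p' Hp' Ipp'; rewrite -[p](subrK p'); apply: ideal_add => //; apply: IH => //.
rewrite -[p'](subKr p) mulrBl; apply: ideal_subr => //; exact: ideal_mulr.
Qed.

(** Buchberger's criterion for coprime initial monomials. In [p = b * g + q] with [q] in the ideal
    of [G], a top of [b * g] beyond the weight of [p] cancels against [q]; then the top of [b] is
    reducible modulo [G], and [b] can be replaced by a polynomial of smaller weight. *)
Lemma initials_in_cons : initials_in ((mu, g) :: G).
Proof.
move=> p d /= [b Ib] Hp m pm em.
have [e] := weight_lt_ex b; elim: e b Ib => [|e IH] b Ib Hb.
  apply/orP; right; apply: (AG _ Hp pm em).
  suff e0 : b = 0 by move: Ib; rewrite e0 mul0r subr0.
  by apply/mpolyP => k; rewrite mcoeff0 (weight_ltE Hb).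
have [le|lt] := leqP (e + weight mu) d.
  have [q0|qm] := eqVneq ((p - b * g)@_m) 0; last first.
    apply/orP; right; apply: (AG Ib _ qm em).
    apply: weight_ltD => //; apply: weight_ltN.
    by apply: weight_ltW (weight_ltMg Hb); rewrite ltnS.
  apply/orP; left; move/eqP: q0; rewrite mcoeffB subr_eq0 => /eqP e1.
  move: pm; rewrite e1 -[g](subrK 'X_[mu]) mulrDr mcoeffD.
  rewrite (weight_ltE (weight_ltM Hb gi)) ?em // add0r -mcoeff_msupp.
  rewrite (perm_mem (msuppMX _ _)) => /mapP[k _ ->] /=.
  exact: lem_addr.
have [] := @reduce_top G b e Gi Hb.
  apply: (@top_in_monomials e b (p - b * g) (-1) Hb Ib).
  - by rewrite oppr_eq0 oner_neq0.
  - apply: weight_ltD; first by apply: weight_ltW Hp; rewrite ltnS ltnW.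
    by apply: weight_ltN; apply: weight_ltMg.
  - move=> k ek; rewrite mcoeffB (mcoeff_top Hb) ?ek // mulN1r.
    by rewrite (weight_ltE Hp) ?sub0r // weightD ek.
move=> b' Hb' Ibb'; apply: (IH b') => //.
have -> : p - b' * g = (p - b * g) + (b - b') * g by rewrite mulrBl addrA subrK.
by apply: ideal_add => //; apply: ideal_mulr.
Qed.

End Step.

Lemma initials_in_coprime G : (forall x, x \in G -> has_initial x) ->
  pairwise (fun x y : 'X_{1..n} * P => coprime_mnm y.1 x.1) G -> initials_in G.
Proof.
elim: G => [|[mu g] G IH] Gi /=.
  by move=> _ p d /= -> _ m; rewrite mcoeff0 eqxx.
case/andP => co pw; have Gi' x : x \in G -> has_initial x.
  by move=> xG; apply: Gi; rewrite inE xG orbT.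
by apply: initials_in_cons => //; [apply: IH|apply: Gi; rewrite mem_head].
Qed.

Lemma coprime_initials_regular x G p :
  (forall y, y \in x :: G -> has_initial y) ->
  pairwise (fun y z : 'X_{1..n} * P => coprime_mnm z.1 y.1) (x :: G) ->
  ideal (map snd G) (p * x.2) -> ideal (map snd G) p.
Proof.
case: x => mu g Gi /= /andP[co pw].
have Gi' y : y \in G -> has_initial y by move=> yG; apply: Gi; rewrite inE yG orbT.
apply: (@initial_regular G mu g Gi') => //; first exact: initials_in_coprime.
by apply: Gi; rewrite mem_head.
Qed.

End InitialForms.

(** * The spinor ring *)

Lemma weight_lt_sum (K : fieldType) n (wt : 'I_n -> nat) d (I : Type) (r : seq I)
    (P : pred I) (F : I -> {mpoly K[n]}) :
  (forall i, P i -> weight_lt wt d (F i)) -> weight_lt wt d (\sum_(i <- r | P i) F i).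
Proof.
move=> H; apply: (big_ind (weight_lt wt d)) => //; first exact: weight_lt0.
by move=> p q; apply: weight_ltD.
Qed.

Section Spinors.
Variables (K : closedFieldType) (N n : nat).
Local Notation P := {mpoly K[n]}.

Section Coordinates.
(* [u (s, al, t)] is the index of the variable v_{t,al} if [s = false] and w_{t,al} if [s = true]. *)
Variable u : bool * bool * 'I_N -> 'I_n.

Definition spinor s al t : P := 'X_(u (s, al, t)).
Definition momentum al be : P := \sum_t spinor false al t * spinor true be t.
Definition bracket s i j : P :=
  spinor s false i * spinor s true j - spinor s true i * spinor s false j.
Definition momenta : seq P :=
  [:: momentum false false; momentum false true; momentum true false; momentum true true].

Lemma momentum_in al be : momentum al be \in momenta.
Proof. by rewrite !inE; case: al; case: be; rewrite eqxx ?orbT. Qed.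

Lemma bracketC s i j : bracket s j i = - bracket s i j.
Proof. by rewrite /bracket; ring. Qed.

End Coordinates.

Section Regularity.
Variable u : bool * bool * 'I_N -> 'I_n.
Hypothesis u_inj : injective u.
Variables i1 i2 i3 i4 : 'I_N.
Hypothesis uniq_i : uniq [:: i1; i2; i3; i4].
Local Notation quad := [:: i1; i2; i3; i4].
Local Notation idx k := (nth i1 quad k).

Variable tab : bool -> bool -> seq nat.

(** Outside the four chosen indices [index] returns 4, beyond the end of the tables, so the default
    weight 0 applies and such terms of a momentum never compete with the initial one. *)
Definition table_weight (x : 'I_n) : nat :=
  if [pick z | u z == x] is Some z then
    nth 0%N (tab z.1.1 z.1.2) (index z.2 quad)
  else 0%N.

Lemma table_weightE s al t :
  table_weight (u (s, al, t)) = nth 0%N (tab s al) (index t quad).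
Proof.
rewrite /table_weight; case: pickP => [z /eqP/u_inj -> //|/(_ (s, al, t))].
by rewrite eqxx.
Qed.

Definition lead_mnm (L : seq (bool * bool * nat)) : 'X_{1..n} :=
  (\sum_(z <- L) U_(u (z.1.1, z.1.2, idx z.2)))%MM.

Local Notation wt := table_weight.

Lemma weight1 x : weight wt U_(x)%MM = wt x.
Proof.
rewrite /weight (bigD1 x) //= mnm1E eqxx mul1n big1 ?addn0 // => y yx.
by rewrite mnm1E eq_sym (negPf yx).
Qed.

Lemma idxK k : (k < 4)%N -> index (idx k) quad = k.
Proof. by move=> k4; rewrite index_uniq. Qed.

Lemma coprime_lead L1 L2 :
  all (fun z => z.2 < 4)%N L1 -> all (fun z => z.2 < 4)%N L2 ->
  ~~ has (fun z => z \in L1) L2 -> coprime_mnm (lead_mnm L1) (lead_mnm L2).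
Proof.
move=> /allP l1 /allP l2 /hasPn dis; apply/forallP => x.
apply/orP; rewrite /lead_mnm !mnm_sumE.
have [y1 /eqP H1|H1] := pickP (fun y : bool * bool * 'I_4 => u (y.1.1, y.1.2, idx y.2) == x); last first.
  left; rewrite big_seq big1 // => -[[s al] k] zL; rewrite mnm1E /=.
  by have /= k4 := l1 _ zL; have /= -> := H1 (s, al, Ordinal k4).
have aux L : all (fun z => z.2 < 4)%N L -> (y1.1, y1.2 : nat) \notin L ->
    (\sum_(z <- L) U_(u (z.1.1, z.1.2, idx z.2))%MM x == 0)%N.
  move=> /allP l yL; rewrite big_seq big1 // => -[[s al] k] zL; rewrite mnm1E /= -H1.
  case: eqP => // /u_inj[e1 e2 /(congr1 (index^~ quad))].
  rewrite !idxK //; last exact: (l _ zL).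
  by move=> e3; case/negP: yL; rewrite /= -e3; move: zL; rewrite e1 e2; case: (y1) => -[].
have [yL|yL] := boolP ((y1.1, y1.2 : nat) \in L1); last by left; apply: aux => //; apply/allP.
right; apply: aux; first exact/allP.
by apply/negP => yL2; have := dis _ yL2; rewrite yL.
Qed.

Lemma initial_momentum al be k : (k < 4)%N ->
  (forall j, j != k -> nth 0 (tab false al) j + nth 0 (tab true be) j
     < nth 0 (tab false al) k + nth 0 (tab true be) k)%N ->
  has_initial wt (lead_mnm [:: (false, al, k); (true, be, k)], momentum u al be).
Proof.
move=> k4 Hk; rewrite /has_initial /lead_mnm /= !big_cons big_nil addm0 /=.
rewrite /momentum (bigD1 (idx k)) //= mpolyXD addrAC subrr add0r.
apply: weight_lt_sum => t tk m; rewrite -mpolyXD mcoeffX; case: (_ =P m) => [<- _|_]; last by rewrite eqxx.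
rewrite !weightD !weight1 !table_weightE idxK //; apply: Hk.
apply: contra tk => /eqP e; have : t \in quad by rewrite -index_mem e.
by move/(nth_index i1) => <-; rewrite e.
Qed.

Lemma initial_bracket s j k : (j < 4)%N -> (k < 4)%N ->
  (nth 0 (tab s true) j + nth 0 (tab s false) k
     < nth 0 (tab s false) j + nth 0 (tab s true) k)%N ->
  has_initial wt (lead_mnm [:: (s, false, j); (s, true, k)], bracket u s (idx j) (idx k)).
Proof.
move=> j4 k4 H; rewrite /has_initial /lead_mnm /= !big_cons big_nil addm0 /=.
rewrite /bracket mpolyXD addrAC subrr add0r; apply: weight_ltN => m.
rewrite -mpolyXD mcoeffX; case: (_ =P m) => [<- _|_]; last by rewrite eqxx.
by rewrite !weightD !weight1 !table_weightE !idxK.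
Qed.

Lemma initial_spinor s al k :
  has_initial wt (lead_mnm [:: (s, al, k)], spinor u s al (idx k)).
Proof.
rewrite /has_initial /lead_mnm /= !big_cons big_nil addm0 /= /spinor subrr.
exact: weight_lt0.
Qed.

End Regularity.

Section RegularSequences.
Variable u : bool * bool * 'I_N -> 'I_n.
Hypothesis u_inj : injective u.
Variables i1 i2 i3 i4 : 'I_N.
Hypothesis uniq_i : uniq [:: i1; i2; i3; i4].

(* Weights found by a computer search. The rows list the weights of the variables of i1, ..., i4. *)
Let tab1 (s al : bool) : seq nat :=
  match s, al with
  | false, false => [:: 0; 4; 4; 4]
  | false, true => [:: 5; 2; 1; 4]
  | true, false => [:: 4; 1; 3; 4]
  | true, true => [:: 1; 5; 2; 4]
  end%N.

Let tab2 (s al : bool) : seq nat :=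
  match s, al with
  | false, false | true, false => [:: 7; 5; 6; 2]
  | false, true | true, true => [:: 4; 0; 7; 9]
  end%N.

Let lead := lead_mnm u i1 i2 i3 i4.

(** The initial monomials of [G1], [x1] and [y1] together involve eleven distinct variables, hence
    are pairwise coprime. The momenta are led by their terms at the fourth, second, first and fourth
    index. *)
Let G1 : seq ('X_{1..n} * P) :=
  [:: (lead [:: (false, false, 3%N); (true, false, 3%N)], momentum u false false);
      (lead [:: (false, false, 1%N); (true, true, 1%N)], momentum u false true);
      (lead [:: (false, true, 0%N); (true, false, 0%N)], momentum u true false);
      (lead [:: (false, true, 3%N); (true, true, 3%N)], momentum u true true)].

Let x1 := (lead [:: (false, false, 2%N); (false, true, 1%N)], bracket u false i3 i2).
Let y1 := (lead [:: (false, false, 0%N)], spinor u false false i1).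

Let init1 x : x \in [:: x1, y1 & G1] -> has_initial (table_weight u i1 i2 i3 i4 tab1) x.
Proof.
rewrite !inE => /or4P[/eqP->|/eqP->|/eqP->|/or3P[] /eqP->].
- exact: (@initial_bracket u u_inj i1 i2 i3 i4 uniq_i tab1 false 2 1).
- exact: (@initial_spinor u i1 i2 i3 i4 tab1 false false 0).
- by apply: initial_momentum => // -[|[|[|[|[|j]]]]].
- by apply: initial_momentum => // -[|[|[|[|[|j]]]]].
- by apply: initial_momentum => // -[|[|[|[|[|j]]]]].
- by apply: initial_momentum => // -[|[|[|[|[|j]]]]].
Qed.

Lemma regular_momenta_bracket p :
  ideal (momenta u) (p * bracket u false i3 i2) -> ideal (momenta u) p.
Proof.
apply: (@coprime_initials_regular K n (table_weight u i1 i2 i3 i4 tab1) x1 G1).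
  move=> y; rewrite in_cons => /orP[e|yG]; apply: init1; rewrite in_cons ?e //.
  by apply/orP; right; rewrite in_cons yG orbT.
by rewrite /= !coprime_lead.
Qed.

Lemma regular_spinor_momenta_bracket p :
  ideal (spinor u false false i1 :: momenta u) (p * bracket u false i3 i2) ->
  ideal (spinor u false false i1 :: momenta u) p.
Proof.
apply: (@coprime_initials_regular K n (table_weight u i1 i2 i3 i4 tab1) x1 (y1 :: G1)).
  exact: init1.
by rewrite /= !coprime_lead.
Qed.

(** A separate table is used because primality of the ideal of a bracket is not established. [tab2]
    treats both kinds of spinors alike, so the two mixed momenta are both led at the third index, by
    different variables, and the brackets take theirs from the first two indices. *)
Lemma regular_bracket_bracket p :
  ideal (bracket u false i2 i1 :: momenta u) (p * bracket u true i2 i1) ->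
  ideal (bracket u false i2 i1 :: momenta u) p.
Proof.
pose G2 : seq ('X_{1..n} * P) :=
  [:: (lead [:: (false, false, 1%N); (false, true, 0%N)], bracket u false i2 i1);
      (lead [:: (false, false, 0%N); (true, false, 0%N)], momentum u false false);
      (lead [:: (false, false, 2%N); (true, true, 2%N)], momentum u false true);
      (lead [:: (false, true, 2%N); (true, false, 2%N)], momentum u true false);
      (lead [:: (false, true, 3%N); (true, true, 3%N)], momentum u true true)].
pose x2 := (lead [:: (true, false, 1%N); (true, true, 0%N)], bracket u true i2 i1).
apply: (@coprime_initials_regular K n (table_weight u i1 i2 i3 i4 tab2) x2 G2).
  move=> x; rewrite !inE => /or4P[/eqP->|/eqP->|/eqP->|/or3P[] /eqP->].
  - exact: (@initial_bracket u u_inj i1 i2 i3 i4 uniq_i tab2 true 1 0).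
  - exact: (@initial_bracket u u_inj i1 i2 i3 i4 uniq_i tab2 false 1 0).
  - by apply: initial_momentum => // -[|[|[|[|[|j]]]]].
  - by apply: initial_momentum => // -[|[|[|[|[|j]]]]].
  - by apply: initial_momentum => // -[|[|[|[|[|j]]]]].
  - by apply: initial_momentum => // -[|[|[|[|[|j]]]]].
by rewrite /= !coprime_lead.
Qed.

End RegularSequences.

End Spinors.

Definition prime_ideal (R : comNzRingType) (gs : seq R) : Prop :=
  forall p q, ideal gs (p * q) -> ideal gs p \/ ideal gs q.

Definition variety (K : comNzRingType) n (gs : seq {mpoly K[n]}) (y : 'I_n -> K) : Prop :=
  forall g, g \in gs -> g.@[y] = 0.

Lemma ideal_variety (K : comNzRingType) n (gs : seq {mpoly K[n]}) p y :
  ideal gs p -> variety gs y -> p.@[y] = 0.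
Proof.
elim: gs p => /= [p -> _|g gs IH p [a Ha] vy]; first by rewrite meval0.
have := IH _ Ha; rewrite mevalB mevalM [g.@[y]]vy ?mem_head // mulr0 subr0; apply.
by move=> h hg; apply: vy; rewrite inE hg orbT.
Qed.

(** * Primality of the momentum ideals by elimination *)

Section PrimeSpinorIdeal.
Variables (K : closedFieldType) (N n : nat) (u : bool * bool * 'I_N -> 'I_n).
Hypothesis u_inj : injective u.
Local Notation P := {mpoly K[n]}.
Local Notation X := (@spinor K N n u).
Local Notation br := (@bracket K N n u).

Variables (b : bool) (t0 i j : 'I_N).
Hypotheses (ij : i != j) (it0 : b -> i != t0) (jt0 : b -> j != t0).

Let gens : seq P := (if b then [:: X false false t0] else [::]) ++ momenta K u.
Let delta := br false i j.

Hypothesis delta_regular : forall p, ideal gens (p * delta) -> ideal gens p.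

Let uE z1 z2 : (u z1 == u z2) = (z1 == z2). Proof. exact: inj_eq. Qed.

Let ji : j != i. Proof. by rewrite eq_sym. Qed.

Definition solved (x : 'I_n) : bool :=
  [exists be, (x == u (true, be, i)) || (x == u (true, be, j))]
  || b && (x == u (false, false, t0)).

(** Independence of the solved variables is expressed by values; over an infinite field this amounts
    to lying in the subring of the other variables, which need not be constructed. *)
Definition unsolved_poly (q : P) : Prop :=
  forall y y', (forall x, ~~ solved x -> y x = y' x) -> q.@[y] = q.@[y'].

Lemma unsolvedX x : ~~ solved x -> unsolved_poly 'X_x.
Proof. by move=> sx y y' e; rewrite !mevalXU e. Qed.

Lemma unsolvedM p q : unsolved_poly p -> unsolved_poly q -> unsolved_poly (p * q).
Proof. by move=> Hp Hq y y' e; rewrite !mevalM (Hp _ _ e) (Hq _ _ e). Qed.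

Lemma unsolvedD p q : unsolved_poly p -> unsolved_poly q -> unsolved_poly (p + q).
Proof. by move=> Hp Hq y y' e; rewrite !mevalD (Hp _ _ e) (Hq _ _ e). Qed.

Lemma unsolvedC c : unsolved_poly c%:MP.
Proof. by move=> y y' _; rewrite !mevalC. Qed.

Lemma unsolved_exp p k : unsolved_poly p -> unsolved_poly (p ^+ k).
Proof.
move=> Hp; elim: k => [|k IH]; first by rewrite expr0 -mpolyC1; apply: unsolvedC.
by rewrite exprS; apply: unsolvedM.
Qed.

Lemma solved_v al t : solved (u (false, al, t)) = [&& b, ~~ al & t == t0].
Proof.
rewrite /solved uE !xpair_eqE /= eqbF_neg.
suff -> : [exists be, (u (false, al, t) == u (true, be, i)) ||
  (u (false, al, t) == u (true, be, j))] = false by [].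
by apply/negbTE/existsP => -[be]; rewrite !uE !xpair_eqE.
Qed.

Lemma solved_w be t : solved (u (true, be, t)) = (t == i) || (t == j).
Proof.
rewrite /solved uE !xpair_eqE /= andbF orbF; apply/existsP/idP => [[be']|H].
  by rewrite !uE !xpair_eqE /= => /orP[]/andP[_ ->]; rewrite ?orbT.
by exists be; rewrite !uE !xpair_eqE /= eqxx.
Qed.

Lemma unsolved_delta : unsolved_poly delta.
Proof.
have v al t : (b -> t != t0) -> unsolved_poly (X false al t).
  move=> H; apply: unsolvedX; rewrite solved_v; case: b H => //= /(_ isT)/negPf->.
  by rewrite andbF.
rewrite /delta /bracket -mulN1r -mpolyC1 -mpolyCN.
by do !(apply: unsolvedD || apply: unsolvedM || apply: unsolvedC || apply: v).
Qed.

(** Says that modulo [gens], with [delta] inverted, [q] comes from the polynomial ring in the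
    unsolved variables. *)
Definition reducible (q : P) : Prop :=
  exists k q', unsolved_poly q' /\ ideal gens (delta ^+ k * q - q').

Lemma reducible_unsolved q : unsolved_poly q -> reducible q.
Proof. by exists 0%N, q; rewrite expr0 mul1r subrr; split=> //; apply: ideal_zero. Qed.

Lemma reducible_ideal q : ideal gens q -> reducible q.
Proof.
exists 0%N, 0; rewrite expr0 mul1r subr0 -mpolyC0; split=> //; exact: unsolvedC.
Qed.

Lemma reducibleM p q : reducible p -> reducible q -> reducible (p * q).
Proof.
move=> [k [p' [Up Ip]]] [l [q' [Uq Iq]]]; exists (k + l)%N, (p' * q').
split; first exact: unsolvedM.
have -> : delta ^+ (k + l) * (p * q) - p' * q' =
  (delta ^+ k * p - p') * (delta ^+ l * q) + p' * (delta ^+ l * q - q').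
  by rewrite exprD; ring.
by apply: ideal_add; [apply: ideal_mulr|apply: ideal_mull].
Qed.

Lemma reducibleD p q : reducible p -> reducible q -> reducible (p + q).
Proof.
move=> [k [p' [Up Ip]]] [l [q' [Uq Iq]]].
exists (k + l)%N, (delta ^+ l * p' + delta ^+ k * q'); split.
  by apply: unsolvedD; apply: unsolvedM => //; apply/unsolved_exp/unsolved_delta.
have -> : delta ^+ (k + l) * (p + q) - (delta ^+ l * p' + delta ^+ k * q') =
  delta ^+ l * (delta ^+ k * p - p') + delta ^+ k * (delta ^+ l * q - q').
  by rewrite exprD; ring.
by apply: ideal_add; apply: ideal_mull.
Qed.

Lemma reducible_delta p s : reducible s -> ideal gens (delta * p - s) -> reducible p.
Proof.
move=> [k [q [Uq Iq]]] Is; exists k.+1, q; split=> //.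
have -> : delta ^+ k.+1 * p - q = delta ^+ k * (delta * p - s) + (delta ^+ k * s - q).
  by rewrite exprS; ring.
by apply: ideal_add => //; apply: ideal_mull.
Qed.

Lemma momentum_gens al be : ideal gens (momentum K u al be).
Proof. by apply: ideal_mem; rewrite mem_cat momentum_in orbT. Qed.

(** Contracting the momenta with the spinor [v_c] replaces each [v_t] by its bracket with [v_c],
    which kills the term [t = c]. *)
Lemma cramer be a c : a != c ->
  ideal gens (br false a c * X true be a
    + \sum_(t | (t != a) && (t != c)) br false t c * X true be t).
Proof.
move=> ac.
have -> : br false a c * X true be a
    + \sum_(t | (t != a) && (t != c)) br false t c * X true be t =
  \sum_t br false t c * X true be t.
  rewrite [RHS](bigD1 a) //=; congr (_ + _); rewrite [RHS](bigD1 c) /=; last by rewrite eq_sym.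
  have -> : br false c c = 0 by rewrite /bracket; ring.
  by rewrite mul0r add0r.
have -> : \sum_t br false t c * X true be t =
  momentum K u false be * X false true c - momentum K u true be * X false false c.
  rewrite /momentum !mulr_suml -sumrB; apply: eq_bigr => t _; rewrite /bracket; ring.
by apply: ideal_subr; apply: ideal_mulr; apply: momentum_gens.
Qed.

Lemma reducible_unsolved_var x : ~~ [exists be, (x == u (true, be, i)) || (x == u (true, be, j))] ->
  reducible 'X_x.
Proof.
move=> nx; case: (boolP (b && (x == u (false, false, t0)))) => [/andP[b1 /eqP ->]|nx'].
  by apply/reducible_ideal/ideal_mem; rewrite /gens b1 inE eqxx.
by apply/reducible_unsolved/unsolvedX; rewrite /solved negb_or nx.
Qed.

Lemma reducible_v al t : reducible (X false al t).
Proof.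
apply: reducible_unsolved_var; apply/negP => /existsP[be].
by rewrite !uE !xpair_eqE.
Qed.

Lemma reducible_rest be c :
  reducible (\sum_(t | (t != i) && (t != j)) br false t c * X true be t).
Proof.
have redC k : reducible k%:MP by apply/reducible_unsolved/unsolvedC.
apply: (big_ind reducible); [by rewrite -mpolyC0|exact: reducibleD|].
move=> t /andP[ti tj]; apply: reducibleM.
  rewrite /bracket -mulN1r -mpolyC1 -mpolyCN.
  by do !(apply: reducibleD || apply: reducibleM || apply: redC || apply: reducible_v).
apply: reducible_unsolved_var; apply/negP => /existsP[be'].
by rewrite !uE !xpair_eqE (negPf ti) (negPf tj) !andbF.
Qed.

Lemma reducible_var x : reducible 'X_x.
Proof.
case: (boolP [exists be, (x == u (true, be, i)) || (x == u (true, be, j))]);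
  last exact: reducible_unsolved_var.
case/existsP => be /orP[]/eqP ->.
  apply: (reducible_delta (s := - \sum_(t | (t != i) && (t != j)) br false t j * X true be t)).
    rewrite -mulN1r -mpolyC1 -mpolyCN; apply: reducibleM (reducible_rest _ _).
    exact/reducible_unsolved/unsolvedC.
  by rewrite opprK; apply: cramer.
apply: (reducible_delta (s := \sum_(t | (t != i) && (t != j)) br false t i * X true be t)).
  exact: reducible_rest.
have := ideal_opp (cramer be ji); rewrite opprD (eq_bigl (fun t => (t != i) && (t != j))).
  by rewrite bracketC mulNr opprK.
by move=> t; rewrite andbC.
Qed.

Lemma reducible_all q : reducible q.
Proof.
elim/mpoly_alg_ind: q => [c|x|p q|p q].
- exact/reducible_unsolved/unsolvedC.
- exact: reducible_var.
- exact: reducibleD.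
- exact: reducibleM.
Qed.

(** The unsolved variables satisfy no relation where [delta] is nonzero: Cramer's rule supplies
    [w_i] and [w_j], and the first component of [v_t0] is set to zero when it is a generator. *)
Lemma variety_extend y : delta.@[y] != 0 ->
  exists2 y', variety gens y' & forall x, ~~ solved x -> y' x = y x.
Proof.
move=> dy; pose y0 x := if b && (x == u (false, false, t0)) then 0 else y x.
have d0 : delta.@[y0] = delta.@[y].
  by apply: unsolved_delta => x; rewrite /solved negb_or /y0 => /andP[_ /negPf ->].
pose B t c := y0 (u (false, false, t)) * y0 (u (false, true, c))
            - y0 (u (false, true, t)) * y0 (u (false, false, c)).
have dB : delta.@[y0] = B i j by rewrite /delta /bracket mevalB !mevalM !mevalXU.
pose S c be := \sum_(t | (t != i) && (t != j)) B t c * y0 (u (true, be, t)).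
pose y' x := if [pick be | x == u (true, be, i)] is Some be then - S j be / B i j
  else if [pick be | x == u (true, be, j)] is Some be then S i be / B i j else y0 x.
have y'v al t : y' (u (false, al, t)) = y0 (u (false, al, t)).
  rewrite /y'; case: pickP => [be|_]; first by rewrite !uE !xpair_eqE.
  by case: pickP => [be|_ //]; rewrite !uE !xpair_eqE.
have y'i be : y' (u (true, be, i)) = - S j be / B i j.
  rewrite /y'; case: pickP => [be'|/(_ be)]; last by rewrite eqxx.
  by rewrite !uE !xpair_eqE /= eqxx andbT => /eqP <-.
have y'j be : y' (u (true, be, j)) = S i be / B i j.
  rewrite /y'; case: pickP => [be'|_]; first by rewrite !uE !xpair_eqE (negPf ji) andbF.
  case: pickP => [be'|/(_ be)]; last by rewrite eqxx.
  by rewrite !uE !xpair_eqE /= eqxx andbT => /eqP <-.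
have y'w be t : t != i -> t != j -> y' (u (true, be, t)) = y0 (u (true, be, t)).
  move=> ti tj; rewrite /y'; case: pickP => [be'|_].
    by rewrite !uE !xpair_eqE (negPf ti) andbF.
  by case: pickP => [be'|_ //]; rewrite !uE !xpair_eqE (negPf tj) andbF.
have B0 : B i j != 0 by rewrite -dB d0.
exists y'; last first.
  move=> x sx; rewrite /y'; case: pickP => [be /eqP ex|_].
    by move: sx; rewrite ex solved_w eqxx.
  case: pickP => [be /eqP ex|_]; first by move: sx; rewrite ex solved_w eqxx orbT.
  by rewrite /y0; move: sx; rewrite /solved negb_or => /andP[_ /negPf ->].
have mom al be : (momentum K u al be).@[y'] = 0.
  rewrite /momentum raddf_sum /= (bigD1 i) //= (bigD1 j) //= !mevalM !mevalXU.
  rewrite y'i y'j !y'v; apply: (mulfI B0); rewrite mulr0 !mulrDr.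
  have -> a : B i j * (a * (- S j be / B i j)) = - (a * S j be) by field.
  have -> a : B i j * (a * (S i be / B i j)) = a * S i be by field.
  rewrite /S !mulr_sumr -sumrN -!big_split /=; apply: big1 => t /andP[ti tj].
  rewrite mevalM !mevalXU y'v y'w // /B; case: al; ring.
move=> g; rewrite mem_cat => /orP[|].
  by case: ifP => // b1; rewrite inE => /eqP ->; rewrite mevalXU y'v /y0 b1 eqxx.
by rewrite !inE => /or4P[] /eqP ->.
Qed.

Lemma delta_neq0 : delta != 0.
Proof.
apply/eqP => /(congr1 (meval (fun x => ((x == u (false, false, i)) || (x == u (false, true, j)))%:R : K))).
rewrite /delta /bracket meval0 mevalB !mevalM !mevalXU !uE !xpair_eqE /= !eqxx /= (negPf ij) (negPf ji) /=.
by rewrite !mulr1 mulr0 subr0 => /eqP; rewrite oner_eq0.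
Qed.

Lemma delta_exp_regular k p : ideal gens (delta ^+ k * p) -> ideal gens p.
Proof.
elim: k p => [p|k IH p]; first by rewrite expr0 mul1r.
by rewrite exprS -mulrA mulrC => /delta_regular/IH.
Qed.

Lemma unsolved_eq0 q : unsolved_poly q ->
  (forall y, variety gens y -> delta.@[y] != 0 -> q.@[y] = 0) -> q = 0.
Proof.
move=> Uq H; have : delta * q = 0; last first.
  by move/eqP; rewrite mulf_eq0 (negPf delta_neq0) => /eqP.
apply: mpoly_eq0_eval => y; rewrite mevalM.
have [->|dy] := eqVneq delta.@[y] 0; first by rewrite mul0r.
have [y' vy ey] := variety_extend dy.
rewrite -(Uq _ _ ey) H ?mulr0 //.
by rewrite (unsolved_delta ey).
Qed.

(** Up to powers of [delta] both factors are unsolved polynomials. Their product vanishes on the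
    variety, hence identically, so one of them is zero; regularity of [delta] removes the powers. *)
Lemma spinor_ideal_prime : prime_ideal gens.
Proof.
move=> p q Ipq; have [k [p' [Up Ip]]] := reducible_all p; have [l [q' [Uq Iq]]] := reducible_all q.
have : p' * q' = 0.
  apply: unsolved_eq0; first exact: unsolvedM.
  move=> y vy _; have := ideal_variety Ip vy; have := ideal_variety Iq vy.
  have := ideal_variety Ipq vy; rewrite !mevalB !mevalM.
  move=> pq /subr0_eq <- /subr0_eq <-.
  by rewrite mulrACA pq mulr0.
move/eqP; rewrite mulf_eq0 => /orP[]/eqP e0; [left|right].
  by apply: (@delta_exp_regular k); move: Ip; rewrite e0 subr0.
by apply: (@delta_exp_regular l); move: Iq; rewrite e0 subr0.
Qed.

Lemma spinor_ideal_vanish q :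
  (forall y, variety gens y -> delta.@[y] != 0 -> q.@[y] = 0) -> ideal gens q.
Proof.
move=> H; have [k [q' [Uq Iq]]] := reducible_all q; apply: (@delta_exp_regular k).
suff e0 : q' = 0 by move: Iq; rewrite e0 subr0.
apply: unsolved_eq0 => // y vy dy; have := ideal_variety Iq vy.
by rewrite mevalB mevalM (H _ vy dy) mulr0 sub0r => /eqP; rewrite oppr_eq0 => /eqP.
Qed.

End PrimeSpinorIdeal.

Ltac all_distinct :=
  by rewrite /= !inE !negb_or; do ?[apply/andP; split] => //; rewrite eq_sym.

(** * Regular pairs modulo a prime ideal *)

Section RegularPairs.
Variables (R : comNzRingType) (gs : seq R).
Hypotheses (prime_gs : prime_ideal gs) (gs1 : ~ ideal gs 1).

Definition regular_pair (x y : R) : Prop :=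
  forall p, ideal (x :: gs) (y * p) -> ideal (x :: gs) p.

Lemma prime_cancel x p : ~ ideal gs x -> ideal gs (x * p) -> ideal gs p.
Proof. by move=> nx /prime_gs[]. Qed.

Lemma prime_mul x y : ~ ideal gs x -> ~ ideal gs y -> ~ ideal gs (x * y).
Proof. by move=> nx ny /prime_gs[]. Qed.

Lemma prime_exp x k : ~ ideal gs x -> ~ ideal gs (x ^+ k).
Proof.
by move=> nx; elim: k => [|k IH]; rewrite ?expr0 // exprS; apply: prime_mul.
Qed.

Lemma prime_prod (I : Type) (r : seq I) (P : pred I) F :
  (forall i, P i -> ~ ideal gs (F i)) -> ~ ideal gs (\prod_(i <- r | P i) F i).
Proof.
by move=> H; apply: (big_ind (fun x => ~ ideal gs x)) => // x y; apply: prime_mul.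
Qed.

Lemma regular_pair_mulr x y z :
  regular_pair x y -> regular_pair x z -> regular_pair x (y * z).
Proof. by move=> Hy Hz p; rewrite -mulrA => /Hy/Hz. Qed.

Lemma regular_pair_mull x y z : ~ ideal gs x ->
  regular_pair x z -> regular_pair y z -> regular_pair (x * y) z.
Proof.
move=> nx Hx Hy p [c Hc].
have [|a Ha] := Hx p; first by exists (c * y); rewrite -mulrA [y * x]mulrC.
have [|d Hd] := Hy a.
  exists c; apply: (prime_cancel nx).
  have -> : x * (z * a - c * y) = (z * p - c * (x * y)) - z * (p - a * x) by ring.
  by apply: ideal_subr => //; apply: ideal_mull.
exists d; have -> : p - d * (x * y) = (p - a * x) + x * (a - d * y) by ring.
by apply: ideal_add => //; apply: ideal_mull.
Qed.

Lemma regular_pair_expr x y k : regular_pair x y -> regular_pair x (y ^+ k).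
Proof.
move=> H; elim: k => [p|k IH]; first by rewrite expr0 mul1r.
by rewrite exprS; apply: regular_pair_mulr.
Qed.

Lemma regular_pair1 y : regular_pair 1 y.
Proof. by move=> p _; exists p; rewrite mulr1 subrr; apply: ideal_zero. Qed.

Lemma regular_pair_expl x y k : ~ ideal gs x -> regular_pair x y -> regular_pair (x ^+ k) y.
Proof.
move=> nx H; elim: k => [|k IH]; first by rewrite expr0; apply: regular_pair1.
by rewrite exprS; apply: regular_pair_mull.
Qed.

Lemma regular_pair_prodl (I : Type) (r : seq I) (P : pred I) F y :
  (forall i, P i -> ~ ideal gs (F i)) -> (forall i, P i -> regular_pair (F i) y) ->
  regular_pair (\prod_(i <- r | P i) F i) y.
Proof.
move=> nF H; elim: r => [|i r IH]; first by rewrite big_nil; apply: regular_pair1.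
rewrite big_cons; case: ifP => // Pi; by apply: regular_pair_mull => //; [exact: nF|exact: H].
Qed.

Lemma regular_pair_prodr (I : Type) (r : seq I) (P : pred I) F x :
  (forall i, P i -> regular_pair x (F i)) -> regular_pair x (\prod_(i <- r | P i) F i).
Proof.
move=> H; apply: (big_ind (regular_pair x)) => //; last exact: regular_pair_mulr.
by move=> p; rewrite mul1r.
Qed.

Lemma regular_pair_prime x y :
  prime_ideal (x :: gs) -> ~ ideal (x :: gs) y -> regular_pair x y.
Proof. by move=> px ny p /px[]. Qed.

(** In [y * p = c * x], regularity of [x] modulo [y] gives [c = d * y], and then [y] cancels in the
    domain. *)
Lemma regular_pair_sym x y : ~ ideal gs y -> regular_pair y x -> regular_pair x y.
Proof.
move=> ny H p [c Hc].
have [|d Hd] := H c.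
  exists p; have -> : x * c - p * y = - (y * p - c * x) by ring.
  exact: ideal_opp.
exists d; apply: (prime_cancel ny).
have -> : y * (p - d * x) = (y * p - c * x) + x * (c - d * y) by ring.
by apply: ideal_add => //; apply: ideal_mull.
Qed.

End RegularPairs.

Section SpinorRing.
Variables (K : closedFieldType) (N n : nat).
Hypothesis N4 : (4 <= N)%N.
Local Notation P := {mpoly K[n]}.

(** Supplies the distinct indices for the weight tables; this is where [4 <= N] enters. *)
Lemma fresh_index (s : seq 'I_N) : (size s < 4)%N -> exists t, t \notin s.
Proof.
move=> s4; apply/existsP; rewrite -negb_forall; apply: contraL N4 => /forallP all_s.
rewrite -ltnNge -[N]card_ord; apply: leq_ltn_trans s4.
apply: leq_trans (card_size s); apply/subset_leq_card/subsetP => t _.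
exact: all_s.
Qed.

(** [s0] exchanges the two kinds of spinors and [al0] their components. Both permute the momenta, so
    a result for one spinor variable carries over to all. *)
Definition twist (u : bool * bool * 'I_N -> 'I_n) (s0 al0 : bool) z :=
  u (z.1.1 (+) s0, z.1.2 (+) al0, z.2).

Variable u : bool * bool * 'I_N -> 'I_n.
Hypothesis u_inj : injective u.
Local Notation X := (@spinor K N n u).
Local Notation br := (@bracket K N n u).
Local Notation E := (momenta K u).

Lemma twist_inj s0 al0 : injective (twist u s0 al0).
Proof.
move=> [[s al] t] [[s' al'] t'] /u_inj[] /addIb -> /addIb -> -> //.
Qed.

Lemma momentum_twist s0 al0 al be : momentum K (twist u s0 al0) al be \in E.
Proof.
have -> : momentum K (twist u s0 al0) al be =
    if s0 then momentum K u (be (+) al0) (al (+) al0)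
    else momentum K u (al (+) al0) (be (+) al0).
  case: s0 => //; rewrite /momentum; apply: eq_bigr => t _; exact: mulrC.
by case: ifP => _; apply: momentum_in.
Qed.

Lemma twistK s0 al0 z : twist (twist u s0 al0) s0 al0 z = u z.
Proof. by case: z => -[s al] t; rewrite /twist /= !addbK. Qed.

Lemma momenta_eq (v v' : bool * bool * 'I_N -> 'I_n) :
  v =1 v' -> momenta K v = momenta K v'.
Proof.
have me al be : v =1 v' -> momentum K v al be = momentum K v' al be.
  by move=> e; apply: eq_bigr => t _; rewrite /spinor !e.
by move=> e; rewrite /momenta !me.
Qed.

Lemma ideal_twist s0 al0 (gs : seq P) p :
  ideal (gs ++ momenta K (twist u s0 al0)) p <-> ideal (gs ++ E) p.
Proof.
have aux (v : bool * bool * 'I_N -> 'I_n) :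
    (forall al be, momentum K (twist v s0 al0) al be \in momenta K v) ->
    ideal (gs ++ momenta K (twist v s0 al0)) p -> ideal (gs ++ momenta K v) p.
  move=> Hv; apply: ideal_incl => g; rewrite mem_cat => /orP[gg|].
    by apply: ideal_mem; rewrite mem_cat gg.
  by rewrite !inE => gE; apply: ideal_mem; rewrite mem_cat; apply/orP; right;
     case/or4P: gE => /eqP->.
split; first by apply: aux => al be; apply: momentum_twist.
move: (aux (twist u s0 al0)); rewrite (momenta_eq (twistK s0 al0)); apply.
move=> al be; have -> : momentum K (twist (twist u s0 al0) s0 al0) al be = momentum K u al be.
  by apply: eq_bigr => t _; rewrite /spinor !twistK.
have := @momentum_in K N n (twist u s0 al0).
have -> : momentum K u al be = if s0 then momentum K (twist u s0 al0) (be (+) al0) (al (+) al0)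
    else momentum K (twist u s0 al0) (al (+) al0) (be (+) al0).
  clear aux; rewrite /momentum /spinor /twist /=; case: s0; apply: eq_bigr => t _; rewrite /= !addbK //.
  exact: mulrC.
by move=> H; clear aux; case: s0 H => H; apply: H.
Qed.

Lemma prime_momenta : prime_ideal E.
Proof.
have [i1 _] := @fresh_index [::] isT; have [i2 H2] := @fresh_index [:: i1] isT.
have [i3 H3] := @fresh_index [:: i1; i2] isT; have [i4 H4] := @fresh_index [:: i1; i2; i3] isT.
rewrite !inE !negb_or in H2 H3 H4; move/andP: H3 => [n31 n32]; move/and3P: H4 => [n41 n42 n43].
apply: (@spinor_ideal_prime K N n u u_inj false i1 i3 i2) => //.
apply: (@regular_momenta_bracket K N n u u_inj i1 i2 i3 i4).
all_distinct.
Qed.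

Lemma momenta_vanish a b q : a != b ->
  (forall y, variety E y -> (br false a b).@[y] != 0 -> q.@[y] = 0) -> ideal E q.
Proof.
move=> ab; have [i3 H3] := @fresh_index [:: a; b] isT.
have [i4 H4] := @fresh_index [:: a; b; i3] isT.
rewrite !inE !negb_or in H3 H4; move/andP: H3 => [n31 n32]; move/and3P: H4 => [n41 n42 n43].
apply: (@spinor_ideal_vanish K N n u u_inj false i3 a b) => //.
apply: (@regular_momenta_bracket K N n u u_inj i3 b a i4).
all_distinct.
Qed.

Lemma prime_spinor_momenta s al t : prime_ideal (X s al t :: E).
Proof.
have Hp : prime_ideal ([:: X s al t] ++ momenta K (twist u s al)).
  have -> : X s al t = spinor K (twist u s al) false false t by [].
  have [i2 H2] := @fresh_index [:: t] isT.
  have [i3 H3] := @fresh_index [:: t; i2] isT; have [i4 H4] := @fresh_index [:: t; i2; i3] isT.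
  rewrite !inE !negb_or in H2 H3 H4; move/andP: H3 => [n31 n32]; move/and3P: H4 => [n41 n42 n43].
  apply: (@spinor_ideal_prime K N n _ (@twist_inj s al) true t i3 i2) => //.
  apply: (@regular_spinor_momenta_bracket K N n _ (@twist_inj s al) t i2 i3 i4).
  all_distinct.
move=> p q; rewrite -[_ :: E]/([:: X s al t] ++ E).
by rewrite -!(ideal_twist s al); apply: Hp.
Qed.

Lemma regular_brackets a b : a != b -> regular_pair E (br true a b) (br false a b).
Proof.
move=> ab; have [i3 H3] := @fresh_index [:: a; b] isT.
have [i4 H4] := @fresh_index [:: a; b; i3] isT.
rewrite !inE !negb_or in H3 H4; move/andP: H3 => [n31 n32]; move/and3P: H4 => [n41 n42 n43].
have H p : ideal ([:: br true a b] ++ E) (p * br false a b) -> ideal ([:: br true a b] ++ E) p.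
  rewrite -!(ideal_twist true false).
  apply: (@regular_bracket_bracket K N n (twist u true false) (@twist_inj true false) b a i3 i4).
  all_distinct.
by move=> p; rewrite mulrC; apply: H.
Qed.

(** Such points, with the other kind of spinor arbitrary, are the witnesses for nonmembership in the
    ideals below. *)
Lemma variety_half s (y : 'I_n -> K) : (forall al t, y (u (s, al, t)) = 0) -> variety E y.
Proof.
move=> H; have mom al be : (momentum K u al be).@[y] = 0.
  rewrite /momentum raddf_sum big1 //= => t _; rewrite mevalM !mevalXU.
  by case: s H => H; rewrite H ?mulr0 ?mul0r.
by move=> g; rewrite !inE => /or4P[] /eqP ->.
Qed.

Lemma spinor_notin (x : option (bool * bool * 'I_N)) s al t : x != Some (s, al, t) ->
  ~ ideal ((if x is Some z then [:: X z.1.1 z.1.2 z.2] else [::]) ++ E) (X s al t).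
Proof.
move=> xz I; pose y k : K := (k == u (s, al, t))%:R.
have uE z : y (u z) = (z == (s, al, t))%:R by rewrite /y (inj_eq u_inj).
have /eqP : (X s al t).@[y] = 0; last by rewrite mevalXU uE eqxx oner_eq0.
apply: (ideal_variety I) => g; rewrite mem_cat => /orP[|]; last first.
  by apply: (@variety_half (~~ s)) => al' t'; rewrite uE !xpair_eqE; case: (s).
case: x xz {I} => [[[s' al'] t']|] //= nz; rewrite inE => /eqP ->.
rewrite mevalXU uE; case: eqP => // e; case/eqP: nz; by rewrite e.
Qed.

Lemma bracket_notin (x : option (bool * bool * 'I_N)) s a b : a != b ->
  ~ ideal ((if x is Some z then [:: X z.1.1 z.1.2 z.2] else [::]) ++ E) (br s a b).
Proof.
move=> ab I; have ba : (b == a) = false by rewrite eq_sym (negPf ab).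
(* [c] selects the monomial of the bracket that avoids the variable [x]; its two variables get value
   1 and all others 0. *)
pose c := if x is Some z then (z == (s, false, a)) || (z == (s, true, b)) else false.
pose y k : K := ((k == u (s, c, a)) || (k == u (s, ~~ c, b)))%:R.
have uE z : y (u z) = ((z == (s, c, a)) || (z == (s, ~~ c, b)))%:R.
  by rewrite /y !(inj_eq u_inj).
have killed z : x = Some z -> ((z == (s, c, a)) || (z == (s, ~~ c, b))) = false.
  rewrite /c => ->; case: z => -[s' al'] t'; rewrite !xpair_eqE.
  case: (s' == s) => //=; case: al'; rewrite /= ?andbT ?andbF ?orbF /= ?eqbF_neg.
    by case: (t' =P b) => [->|] //=; rewrite ?ba ?andbF ?orbF.
  by case: (t' =P a) => [->|] //=; rewrite ?(negPf ab) ?andbF ?orbF.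
have /eqP : (br s a b).@[y] = 0; last first.
  rewrite /bracket mevalB !mevalM !mevalXU !uE !xpair_eqE !eqxx /= (negPf ab) ba /=.
  by case: (c); rewrite /= ?mulr0 ?mul0r ?mulr1 ?sub0r ?subr0 ?oppr_eq0 oner_eq0.
apply: (ideal_variety I) => g; rewrite mem_cat => /orP[|]; last first.
  apply: (@variety_half (~~ s)) => al' t'; rewrite uE !xpair_eqE.
  by case: (s); rewrite ?andbF.
case ex: x => [z|] //; rewrite inE => /eqP ->.
by case: z ex => -[s' al'] t' /= /killed e; rewrite mevalXU uE e.
Qed.

Lemma one_notin : ~ ideal E 1.
Proof.
move=> I; have := ideal_variety I (@variety_half true (fun=> 0) (fun _ _ => erefl)).
by rewrite meval1 => /eqP; rewrite oner_eq0.
Qed.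

Lemma spinor_nz s al t : ~ ideal E (X s al t).
Proof. exact: (@spinor_notin None). Qed.

Lemma bracket_nz s a b : a != b -> ~ ideal E (br s a b).
Proof. exact: (@bracket_notin None). Qed.

Lemma momenta_vanish_away F q : ~ ideal E F ->
  (forall y, variety E y -> F.@[y] != 0 -> q.@[y] = 0) -> ideal E q.
Proof.
move=> nF H; apply: (prime_cancel prime_momenta nF).
have [a _] := @fresh_index [::] isT; have [b] := @fresh_index [:: a] isT.
rewrite inE => ba; apply: (momenta_vanish ba) => y vy _; rewrite mevalM.
by have [->|Fy] := eqVneq F.@[y] 0; [rewrite mul0r|rewrite H ?mulr0].
Qed.

(** For [s = c = false] this is the image in the spinor ring of the product of all [a_t] times a
    minor of the rows [a, b]; for [s = c = true] the same with [d] in place of [a], up to the order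
    of the two indices. *)
Definition chart_fun (s c : bool) a b : P :=
  \prod_t (X false c t * X true c t) * (X s c a * X s c b * br (~~ s) a b).

Lemma chart_fun_nz s c a b : a != b -> ~ ideal E (chart_fun s c a b).
Proof.
have pm := prime_mul prime_momenta.
move=> ab; apply: (pm).
  apply: (prime_prod prime_momenta one_notin) => t _; apply: (pm); exact: spinor_nz.
by apply: (pm); [apply: (pm); apply: spinor_nz|apply: bracket_nz].
Qed.

(** One side has spinor components [false] and a bracket of [w], the other components [true] and a
    bracket of [v]. Pairs containing a spinor of the first side follow from primality of [E] with
    that spinor, pairs with a spinor of the second side by symmetry, and the two brackets from
    [regular_brackets]. *)
Lemma regular_charts a b k l : a != b ->
  regular_pair E (chart_fun false false a b ^+ k) (chart_fun true true a b ^+ l).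
Proof.
move=> ab; have pm := prime_mul prime_momenta; have nz := spinor_nz.
apply: regular_pair_expr; apply: (regular_pair_expl prime_momenta).
  exact: chart_fun_nz.
have spinor_chart s t : regular_pair E (X s false t) (chart_fun true true a b).
  apply: regular_pair_prime; first exact: prime_spinor_momenta.
  have n1 s' t' : ~ ideal (X s false t :: E) (X s' true t').
    by apply: (@spinor_notin (Some (s, false, t))); apply/eqP => -[].
  have pm' := prime_mul (@prime_spinor_momenta s false t).
  apply: (pm'); last first.
    apply: (pm'); first by apply: (pm'); apply: n1.
    exact: (@bracket_notin (Some (s, false, t))).
  apply: (prime_prod (@prime_spinor_momenta s false t)).
    by move=> /(ideal_mulr (X false true t)); rewrite mul1r; apply: n1.
  by move=> t' _; apply: (pm').
have bracket_spinor s t : regular_pair E (br true a b) (X s true t).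
  apply: (regular_pair_sym prime_momenta); first exact: nz.
  apply: regular_pair_prime; first exact: prime_spinor_momenta.
  exact: (@bracket_notin (Some (s, true, t))).
apply: (regular_pair_mull prime_momenta).
- by apply: (prime_prod prime_momenta one_notin) => t _; apply: (pm); apply: (nz).
- apply: (regular_pair_prodl prime_momenta) => t _; first by apply: (pm); apply: (nz).
  by apply: (regular_pair_mull prime_momenta) => //; apply: (nz).
apply: (regular_pair_mull prime_momenta); first by apply: (pm); apply: (nz).
  by apply: (regular_pair_mull prime_momenta) => //; apply: (nz).
apply: regular_pair_mulr.
  by apply: regular_pair_prodr => t _; apply: regular_pair_mulr.
by apply: regular_pair_mulr; [apply: regular_pair_mulr|apply: regular_brackets].
Qed.

End SpinorRing.

(** * The Segre map *)

Arguments ideal : simpl never.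

Section LinearExtension.
Variables (K : comNzRingType) (n : nat) (V : lmodType K) (L : 'X_{1..n} -> V).

Definition linext (p : {mpoly K[n]}) : V := \sum_(m <- msupp p) p@_m *: L m.

Lemma linextE k p : (msize p <= k)%N ->
  linext p = \sum_(m : 'X_{1..n < k}) p@_m *: L m.
Proof.
move=> le_pk; rewrite /linext (big_mksub 'X_{1..n < k}) ?msupp_uniq //=; first last.
  by move=> x /msize_mdeg_lt /leq_trans; apply.
by rewrite big_rmcond //= => j /memN_msupp_eq0 ->; rewrite scale0r.
Qed.

Lemma linextD p q : linext (p + q) = linext p + linext q.
Proof.
pose k := maxn (msize (p + q)) (maxn (msize p) (msize q)).
rewrite !(@linextE k) /k ?leq_max ?leqnn ?orbT // -big_split; apply: eq_bigr => m _.
by rewrite mcoeffD scalerDl.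
Qed.

Lemma linextZ c p : linext (c *: p) = c *: linext p.
Proof.
pose k := maxn (msize (c *: p)) (msize p).
rewrite !(@linextE k) /k ?leq_max ?leqnn ?orbT // scaler_sumr; apply: eq_bigr => m _.
by rewrite mcoeffZ scalerA.
Qed.

Lemma linext0 : linext 0 = 0.
Proof. by rewrite -(scale0r 0) linextZ scale0r. Qed.

Lemma linextX m : linext 'X_[m] = L m.
Proof. by rewrite /linext msuppX big_seq1 mcoeffX eqxx scale1r. Qed.

Lemma linext_sum (I : Type) (r : seq I) (P : pred I) F :
  linext (\sum_(i <- r | P i) F i) = \sum_(i <- r | P i) linext (F i).
Proof. exact: (big_morph linext linextD linext0). Qed.

End LinearExtension.

Section Segre.
Variable N : nat.
Local Notation P := (Pol N).

Definition entry_row (e : 'I_4) : bool := (1 < e)%N.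
Definition entry_col (e : 'I_4) : bool := odd e.
Definition entry (r c : bool) : 'I_4 := inord (r.*2 + c).

Lemma entry_rowE r c : entry_row (entry r c) = r.
Proof. by rewrite /entry_row inordK; case: r; case: c. Qed.

Lemma entry_colE r c : entry_col (entry r c) = c.
Proof. by rewrite /entry_col inordK; case: r; case: c. Qed.

Lemma entryK e : entry (entry_row e) (entry_col e) = e.
Proof.
by apply: val_inj; rewrite /= inordK; case: e => [[|[|[|[|e]]]]] //= lt; rewrite !ltnS ltn0 in lt.
Qed.

(** The spinor variables are those of [Pol N] reread: [v_t] sits in the places of [a_t, b_t] and
    [w_t] in those of [c_t, d_t], so [segre] maps [Pol N] to itself. *)
Definition spinor_index (z : bool * bool * 'I_N) : 'I_(N * 4) :=
  mxvec_index z.2 (entry z.1.1 z.1.2).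

Lemma mxvec_index_inj (t t' : 'I_N) (e e' : 'I_4) :
  mxvec_index t e = mxvec_index t' e' -> t = t' /\ e = e'.
Proof.
move=> H; have := mxvecE (\matrix_(i < N, j < 4) (i, j)) t e.
by rewrite H mxvecE !mxE => -[].
Qed.

Lemma spinor_index_inj : injective spinor_index.
Proof.
move=> [[s al] t] [[s' al'] t'] /mxvec_index_inj /= [-> e].
have := congr1 entry_row e; have := congr1 entry_col e.
by rewrite !entry_rowE !entry_colE => -> ->.
Qed.

Lemma mxvec_index_ex (x : 'I_(N * 4)) : exists t e, x = mxvec_index t e.
Proof. by case/mxvec_indexP: x => t e; exists t, e. Qed.

Local Notation X := (@spinor CC N (N * 4) spinor_index).
Local Notation E := (momenta CC spinor_index).

Definition segre_mx : 'M[P]_(N, 4) :=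
  \matrix_(t, e) (X false (entry_row e) t * X true (entry_col e) t).

Definition segre : P -> P := mmap (@mpolyC (N * 4) CC) (mxvec segre_mx 0).

HB.instance Definition _ := GRing.RMorphism.on segre.

Lemma segreC c : segre c%:MP = c%:MP.
Proof. exact: mmapC. Qed.

Lemma segre_var t e : segre (var t e) = X false (entry_row e) t * X true (entry_col e) t.
Proof. by rewrite /segre /var mmapX mmap1U mxvecE mxE. Qed.

Lemma segre_sumgen e : segre (sumgen N e) = momentum CC spinor_index (entry_row e) (entry_col e).
Proof. by rewrite /sumgen rmorph_sum; apply: eq_bigr => t _; exact: segre_var. Qed.

Lemma segre_Qgen t : segre (Qgen t) = 0.
Proof.
rewrite /Qgen rmorphB !rmorphM /= !segre_var /=.
by rewrite /entry_row /entry_col /=; ring.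
Qed.

Lemma inI_zero : @inI N 0.
Proof.
exists (fun=> 0), (fun=> 0).
by rewrite !big1 ?addr0 // => *; rewrite mul0r.
Qed.

Lemma inI_add p q : @inI N p -> inI q -> inI (p + q).
Proof.
move=> [q1 [q2 ->]] [r1 [r2 ->]]; exists (fun e => q1 e + r1 e), (fun t => q2 t + r2 t).
rewrite addrACA -!big_split; congr (_ + _); apply: eq_bigr => i _; exact/esym/mulrDl.
Qed.

Lemma inI_mul a p : @inI N p -> inI (a * p).
Proof.
move=> [q1 [q2 ->]]; exists (fun e => a * q1 e), (fun t => a * q2 t).
rewrite mulrDr !mulr_sumr; congr (_ + _); apply: eq_bigr => i _; exact: mulrA.
Qed.

Lemma inI_opp p : @inI N p -> inI (- p).
Proof. by rewrite -mulN1r; apply: inI_mul. Qed.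

Lemma inI_sub p q : @inI N p -> inI q -> inI (p - q).
Proof. by move=> Hp /inI_opp; apply: inI_add. Qed.

Lemma inI_trans p q r : @inI N (p - q) -> inI (q - r) -> inI (p - r).
Proof. by move=> H1 H2; rewrite -[p](subrK q) -addrA; apply: inI_add. Qed.

Lemma inI_sumgen e : @inI N (sumgen N e).
Proof.
exists (fun e' => (e' == e)%:R), (fun=> 0).
rewrite (bigD1 e) //= eqxx mul1r big1 => [|e' /negPf ->]; last by rewrite mul0r.
by rewrite big1 ?addr0 // => t _; rewrite mul0r.
Qed.

Lemma inI_Qgen t : @inI N (Qgen t).
Proof.
exists (fun=> 0), (fun t' => (t' == t)%:R).
rewrite big1 => [|e _]; last by rewrite mul0r.
rewrite add0r (bigD1 t) //= eqxx mul1r big1 ?addr0 // => t' /negPf ->.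
by rewrite mul0r.
Qed.

Lemma segre_inI p : inI p -> ideal E (segre p).
Proof.
move=> [q1 [q2 ->]]; rewrite rmorphD !rmorph_sum /=.
apply: ideal_add; apply: ideal_sum => i _; rewrite rmorphM /=.
  by apply/ideal_mull; rewrite segre_sumgen; apply/ideal_mem/momentum_in.
by rewrite segre_Qgen mulr0; apply: ideal_zero.
Qed.

Local Notation ex m s al t := (m (spinor_index (s, al, t))).

Definition balanced (m : 'X_{1..N * 4}) : bool :=
  [forall t, ex m false false t + ex m false true t == ex m true false t + ex m true true t]%N.

(** The preimage at [t] of a balanced monomial, in normal form modulo [Qgen t]: products [a d]
    become [b c], so [a] and [d] never occur together. *)
Definition lift_factor (m : 'X_{1..N * 4}) (t : 'I_N) : P :=
  if (ex m true true t <= ex m false false t)%N then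
    va t ^+ (ex m false false t - ex m true true t) * vb t ^+ ex m true true t
      * vc t ^+ ex m false true t
  else vb t ^+ ex m false false t * vc t ^+ ex m true false t
      * vd t ^+ (ex m true true t - ex m false false t).

Definition lift_mnm (m : 'X_{1..N * 4}) : P :=
  if balanced m then \prod_t lift_factor m t else 0.

Definition step_mnm t r c : 'X_{1..N * 4} :=
  (U_(spinor_index (false, r, t)) + U_(spinor_index (true, c, t)))%MM.

Lemma step_mnmE t r c s al t' :
  ex (step_mnm t r c) s al t' = ((t == t') && ((if s then c else r) == al)) :> nat.
Proof.
rewrite mnmDE !mnm1E !(inj_eq spinor_index_inj) !xpair_eqE.
by case: s; case: (t == t'); rewrite ?andbF ?andbT //=; case: (_ == al).
Qed.

Lemma step_mnmD t r c m s al t' :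
  ex (step_mnm t r c + m)%MM s al t' =
    (((t == t') && ((if s then c else r) == al)) + ex m s al t')%N.
Proof. by rewrite mnmDE step_mnmE. Qed.

Lemma balanced_step t r c m : balanced (step_mnm t r c + m) = balanced m.
Proof.
apply: eq_forallb => t'; rewrite !step_mnmD.
by case: (t == t') => //=; case: r; case: c; rewrite /= ?add0n ?add1n ?addSn ?addnS ?eqSS.
Qed.

(** The two sides differ by a multiple of [Qgen t] when the new entry creates a product [a d], and
    agree otherwise. *)
Lemma lift_factor_step t r c m : balanced m ->
  inI (lift_factor (step_mnm t r c + m) t - var t (entry r c) * lift_factor m t).
Proof.
move=> /forallP/(_ t); rewrite /lift_factor !step_mnmD eqxx /=.
move: (ex m _ _ _) (ex m false true t) (ex m true false t) (ex m true true t) => i j k l.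
have Qk x : @inI N (x * Qgen t) by apply/inI_mul/inI_Qgen.
have inI_eq (p q : P) : p = q -> @inI N (p - q) by move=> ->; rewrite subrr; apply: inI_zero.
have e00 : entry false false = 0 by apply: val_inj; rewrite /= inordK.
have e01 : entry false true = 1 by apply: val_inj; rewrite /= inordK.
have e10 : entry true false = 2 by apply: val_inj; rewrite /= inordK.
have e11 : entry true true = 3 by apply: val_inj; rewrite /= inordK.
rewrite -/(va t) -/(vb t) -/(vc t) -/(vd t).
case: r; case: c; rewrite /= ?add0n ?add1n => /eqP bal.
- rewrite e11 -/(vd t); have [lt|] := ltnP l i.
    rewrite ltnW //.
    have -> : va t ^+ (i - l.+1) * vb t ^+ l.+1 * vc t ^+ j.+1 -
        vd t * (va t ^+ (i - l) * vb t ^+ l * vc t ^+ j) =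
      - (va t ^+ (i - l.+1) * vb t ^+ l * vc t ^+ j) * Qgen t.
      have -> : (i - l = (i - l.+1).+1)%N by lia.
      by rewrite !exprS /Qgen; ring.
    exact: Qk.
  rewrite leq_eqVlt => /orP[/eqP e|lt].
    rewrite -e leqnn subnn subSnn; apply: inI_eq.
    have -> : k = j by lia.
    by rewrite expr0 expr1; ring.
  rewrite leqNgt lt /=; apply: inI_eq.
  by rewrite subSn ?(ltnW lt) // exprS; ring.
- rewrite e10 -/(vc t); apply: inI_eq; case: ifP => _; rewrite !exprS; ring.
- rewrite e01 -/(vb t); apply: inI_eq; rewrite ltnS !subSS; case: ifP => _; rewrite !exprS; ring.
- rewrite e00 -/(va t); have [le|lt] := leqP l i.
    rewrite leqW //; apply: inI_eq.
    by rewrite subSn // exprS; ring.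
  have [e|lt'] : l = i.+1 \/ (i.+1 < l)%N by lia.
    rewrite e leqnn subnn subSnn.
    have -> : j = k.+1 by lia.
    have -> : va t ^+ 0 * vb t ^+ i.+1 * vc t ^+ k.+1 - va t * (vb t ^+ i * vc t ^+ k * vd t ^+ 1)
      = - (vb t ^+ i * vc t ^+ k) * Qgen t.
      by rewrite !exprS !expr0 /Qgen; ring.
    exact: Qk.
  rewrite leqNgt lt' /=.
  have -> : vb t ^+ i.+1 * vc t ^+ k.+1 * vd t ^+ (l - i.+1) -
      va t * (vb t ^+ i * vc t ^+ k * vd t ^+ (l - i)) =
      - (vb t ^+ i * vc t ^+ k * vd t ^+ (l - i.+1)) * Qgen t.
    have -> : (l - i = (l - i.+1).+1)%N by lia.
    by rewrite !exprS /Qgen; ring.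
  exact: Qk.
Qed.

Lemma lift_mnm_step t r c m :
  inI (lift_mnm (step_mnm t r c + m) - var t (entry r c) * lift_mnm m).
Proof.
rewrite /lift_mnm balanced_step; case: ifP => bal; last first.
  by rewrite mulr0 subr0; apply: inI_zero.
rewrite (bigD1 t) //= [\prod_t0 lift_factor m t0](bigD1 t) //= mulrA.
have -> : \prod_(i | i != t) lift_factor (step_mnm t r c + m) i = \prod_(i | i != t) lift_factor m i.
  apply: eq_bigr => t' tt'; rewrite /lift_factor !step_mnmD.
  by rewrite eq_sym (negPf tt').
by rewrite -mulrBl mulrC; apply/inI_mul/lift_factor_step.
Qed.

(** The Reynolds operator of the torus scaling each [v_t] and inversely [w_t], with values read in
    [Pol N] modulo [I_N]. *)
Definition segre_lift : P -> P := linext lift_mnm.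

Lemma lift_segre_mul p q : inI (segre_lift (segre p * q) - p * segre_lift q).
Proof.
elim/mpoly_alg_ind: p q => [c|x|p p' IH IH'|p p' IH IH'] q.
- rewrite segreC !mul_mpolyC /segre_lift linextZ subrr; exact: inI_zero.
- have [t [e ->]] := mxvec_index_ex x; rewrite -/(var t e) segre_var.
  elim/mpolyind: q => [|c m q _ _ IH].
    by rewrite mulr0 /segre_lift linext0 mulr0 subr0; apply: inI_zero.
  rewrite mulrDr /segre_lift linextD -!/(segre_lift _) [segre_lift (_ *: _ + _)]linextD mulrDr.
  have aux (p1 p2 p3 p4 : P) : p1 + p2 - (p3 + p4) = (p1 - p3) + (p2 - p4) by ring.
  rewrite aux; apply: inI_add; last exact: IH.
  rewrite -scalerAr /segre_lift !linextZ -scalerAr -scalerBr -mul_mpolyC; apply: inI_mul.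
  have -> : X false (entry_row e) t * X true (entry_col e) t * 'X_[m] =
      'X_[step_mnm t (entry_row e) (entry_col e) + m] by rewrite !mpolyXD.
  rewrite !linextX; have := lift_mnm_step t (entry_row e) (entry_col e) m.
  by rewrite entryK.
- rewrite rmorphD mulrDl /segre_lift linextD mulrDl opprD addrACA.
  by apply: inI_add; [apply: IH|apply: IH'].
- rewrite rmorphM /= -mulrA; apply: inI_trans (IH _) _.
  have aux (p1 p2 p3 p4 : P) : p1 * p2 - p1 * p3 * p4 = p1 * (p2 - p3 * p4) by ring.
  rewrite aux; apply: inI_mul; exact: IH'.
Qed.

Lemma lift1 : segre_lift 1 = 1.
Proof.
rewrite /segre_lift -{1}mpolyX0 linextX /lift_mnm.
have -> : balanced 0 by apply/forallP => t; rewrite !mnm0E.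
by rewrite big1 // => t _; rewrite /lift_factor !mnm0E /= subnn !expr0 !mulr1.
Qed.

Lemma momenta_lift q : ideal E q -> inI (segre_lift q).
Proof.
have base r c a : inI (segre_lift (a * momentum CC spinor_index r c)).
  have := lift_segre_mul (sumgen N (entry r c)) a.
  rewrite segre_sumgen entry_rowE entry_colE mulrC => H.
  rewrite -[segre_lift _](subrK (sumgen N (entry r c) * segre_lift a)).
  apply: inI_add => //; rewrite mulrC; apply/inI_mul/inI_sumgen.
move=> [a1 [a2 [a3 [a4 /eqP]]]]; rewrite !subr_eq add0r => /eqP ->.
have lift_add p p' : segre_lift (p + p') = segre_lift p + segre_lift p' by exact: linextD.
by rewrite !lift_add; do !apply: inI_add => //; apply: base.
Qed.

(** [segre_lift] is linear over [R] modulo [I_N], fixes 1 and maps [E] into [I_N], hence is a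
    retraction. Together with [prime_momenta] this makes [R] a domain. *)
Lemma segreP p : inI p <-> ideal E (segre p).
Proof.
split; first exact: segre_inI.
move=> /momenta_lift Ip; have := lift_segre_mul p 1; rewrite mulr1 lift1 mulr1 => H.
by rewrite -[p](subKr (segre_lift (segre p))); apply: inI_sub.
Qed.

End Segre.

(** * The module as a weight component of the spinor ring *)

Section SpinorModule.
Variables (N n2h : nat) (sigma : 'I_N -> bool).
Local Notation P := (Pol N).
Local Notation X := (@spinor CC N (N * 4) (@spinor_index N)).
Local Notation E := (momenta CC (@spinor_index N)).
Local Notation ex m s al t := ((m : 'X_{1..N * 4}) (spinor_index (s, al, t))).
Local Notation idx := (idx N n2h).
Local Notation segre := (@segre N).
Local Notation lift_mnm := (@lift_mnm N).

Definition spin_monomial s (t : 'I_N) (k : 'I_n2h.+1) : P :=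
  X s false t ^+ (n2h - k) * X s true t ^+ k.

Definition out_monomial (r : idx) : P := \prod_t spin_monomial (~~ sigma t) t (r t).
Definition in_monomial (c : idx) : P := \prod_t spin_monomial (sigma t) t (c t).

(* The matrix [S^{2h} k_t] is a column of monomials in one spinor times a row of monomials in the
   other; cancelling the columns identifies [K v] with [spinor_form v]. *)
Definition spinor_form (v : idx -> P) : P := \sum_(c : idx) in_monomial c * segre (v c).

Lemma segre_abcd t :
  [/\ segre (va t) = X false false t * X true false t,
      segre (vb t) = X false false t * X true true t,
      segre (vc t) = X false true t * X true false t &
      segre (vd t) = X false true t * X true true t].
Proof. by split; rewrite segre_var. Qed.

Lemma segre_Splus t i j :
  segre (Splus (va t) (vb t) (vc t) (vd t) i j) =
    spin_monomial false t i * spin_monomial true t j.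
Proof.
have [ea eb ec ed] := segre_abcd t.
have li := leq_ord i; have lj := leq_ord j.
rewrite /Splus /spin_monomial; case: ifP => le; rewrite !rmorphM !rmorphXn /= ?ea ?eb ?ec ?ed !exprMn.
  have -> : (n2h - i = (n2h - i - j) + j)%N by lia.
  have -> : (n2h - j = (n2h - i - j) + i)%N by lia.
  have -> : (n2h - i - j + j - j = n2h - i - j)%N by lia.
  by rewrite !exprD; ring.
have -> : (X false true t ^+ i = X false true t ^+ (n2h - j) * X false true t ^+ (i + j - n2h)).
  by rewrite -exprD; congr (_ ^+ _); lia.
have -> : (X true true t ^+ j = X true true t ^+ (n2h - i) * X true true t ^+ (i + j - n2h)).
  by rewrite -exprD; congr (_ ^+ _); lia.
by ring.
Qed.

Lemma segre_Kron r c : segre (Kron sigma r c) = out_monomial r * in_monomial c.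
Proof.
rewrite /Kron rmorph_prod /out_monomial /in_monomial -big_split.
apply: eq_bigr => t _; rewrite /= /Ssig; case: (sigma t); rewrite segre_Splus //=.
exact: mulrC.
Qed.

Lemma segre_Kv v r : segre (Kv sigma v r) = out_monomial r * spinor_form v.
Proof.
rewrite /Kv rmorph_sum /spinor_form mulr_sumr; apply: eq_bigr => c _.
by rewrite rmorphM /= segre_Kron mulrA.
Qed.

Lemma mpolyX_spinors m : 'X_[m] = \prod_t
  (X false false t ^+ ex m false false t * X false true t ^+ ex m false true t *
   (X true false t ^+ ex m true false t * X true true t ^+ ex m true true t)) :> P.
Proof.
rewrite mpolyXE_id (reindex _ (curry_mxvec_bij N 4)) /=.
rewrite (eq_bigr (fun z : 'I_N * 'I_4 => 'X_(mxvec_index z.1 z.2) ^+ m (mxvec_index z.1 z.2)));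
  last by case.
rewrite -(pair_bigA _ (fun t e => ('X_(mxvec_index t e) : P) ^+ m (mxvec_index t e))) /=.
apply: eq_bigr => t _; rewrite !big_ord_recl big_ord0 mulr1 -mulrA.
rewrite /spinor /spinor_index /=.
have e0 : entry false false = ord0 by apply: val_inj; rewrite /= inordK.
have e1 : entry false true = lift ord0 ord0 by apply: val_inj; rewrite /= inordK.
have e2 : entry true false = lift ord0 (lift ord0 ord0) by apply: val_inj; rewrite /= inordK.
have e3 : entry true true = lift ord0 (lift ord0 (lift ord0 ord0)) by apply: val_inj; rewrite /= inordK.
by rewrite e0 e1 e2 e3.
Qed.

Lemma segre_lift_mnm m : balanced m -> segre (lift_mnm m) = 'X_[m].
Proof.
move=> bal; rewrite /lift_mnm bal rmorph_prod mpolyX_spinors.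
apply: eq_bigr => t _; move/forallP/(_ t)/eqP: bal; rewrite /= /lift_factor.
have [ea eb ec ed] := segre_abcd t.
move: (ex m false false t) (ex m false true t) (ex m true false t) (ex m true true t) => i j k l e.
case: leqP => le; rewrite !rmorphM !rmorphXn /= ?ea ?eb ?ec ?ed !exprMn.
  have -> : (i = (i - l) + l)%N by lia.
  have -> : k = (i - l + j)%N by lia.
  have -> : (i - l + l - l = i - l)%N by lia.
  by rewrite !exprD; ring.
have -> : (l = i + (l - i))%N by lia.
have -> : j = (k + (l - i))%N by lia.
have -> : (i + (l - i) - i = l - i)%N by lia.
by rewrite !exprD; ring.
Qed.

Definition in_mnm (c : idx) : 'X_{1..N * 4} :=
  (\sum_t (U_(spinor_index (sigma t, false, t)) *+ (n2h - c t)
         + U_(spinor_index (sigma t, true, t)) *+ c t))%MM.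

Lemma in_mnmE c s al t : ex (in_mnm c) s al t =
  if s == sigma t then (if al then nat_of_ord (c t) else (n2h - c t)%N) else 0%N.
Proof.
rewrite /in_mnm mnm_sumE (bigD1 t) //= big1 => [|t' t't].
  rewrite addn0 mnmDE !mulmnE !mnm1E !(inj_eq (@spinor_index_inj N)) !xpair_eqE eqxx !andbT.
  rewrite [sigma t == s]eq_sym; case: (s == sigma t); case: al; rewrite /= ?mul0n ?mul1n ?muln0 ?addn0 //=.
rewrite mnmDE !mulmnE !mnm1E !(inj_eq (@spinor_index_inj N)) !xpair_eqE (negPf t't).
by rewrite !andbF.
Qed.

Lemma in_monomialE c : in_monomial c = 'X_[in_mnm c].
Proof.
rewrite mpolyX_spinors; apply: eq_bigr => t _; rewrite !in_mnmE /spin_monomial.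
by case: (sigma t); rewrite /= !expr0 ?mulr1 ?mul1r.
Qed.

Definition spin_weight (m : 'X_{1..N * 4}) : bool :=
  [forall t, ex m (sigma t) false t + ex m (sigma t) true t ==
             ex m (~~ sigma t) false t + ex m (~~ sigma t) true t + n2h]%N.

Lemma spin_weight_step t r c m : spin_weight (step_mnm t r c + m) = spin_weight m.
Proof.
apply: eq_forallb => t'; rewrite !step_mnmD.
by case: (t == t') => //=; case: (sigma t'); case: r; case: c;
  rewrite /= ?add0n ?add1n ?addSn ?addnS ?addSn ?eqSS.
Qed.

Lemma spin_weight_in c : spin_weight (in_mnm c).
Proof.
apply/forallP => t; rewrite !in_mnmE eqxx.
by have := leq_ord (c t); case: (sigma t); rewrite /= addn0 add0n => le; rewrite subnK.
Qed.

Definition spin_proj : P -> P :=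
  linext (fun m => if spin_weight m then 'X_[m] else 0 : P).

(** Elements of [R] have weight zero, so the projection to the weight of [M] is linear over [R]. *)
Lemma spin_proj_segre p q : spin_proj (segre p * q) = segre p * spin_proj q.
Proof.
elim/mpoly_alg_ind: p q => [c|x|p p' IH IH'|p p' IH IH'] q.
- by rewrite segreC !mul_mpolyC /spin_proj linextZ.
- have [t [e ->]] := mxvec_index_ex x; rewrite -/(var t e) segre_var.
  elim/mpolyind: q => [|c m q _ _ IH]; first by rewrite mulr0 /spin_proj linext0 mulr0.
  rewrite mulrDr {1}/spin_proj linextD -!/(spin_proj _) IH.
  rewrite [spin_proj (_ + _)]linextD mulrDr; congr (_ + _).
  rewrite -scalerAr /spin_proj !linextZ -scalerAr; congr (_ *: _).
  have eX : X false (entry_row e) t * X true (entry_col e) t * 'X_[m] =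
      'X_[step_mnm t (entry_row e) (entry_col e) + m] by rewrite !mpolyXD.
  by rewrite eX !linextX spin_weight_step; case: ifP => _; rewrite ?mulr0.
- have -> : segre (p + p') * q = segre p * q + segre p' * q by rewrite rmorphD mulrDl.
  by rewrite [LHS]linextD [segre (p + p')]rmorphD mulrDl; congr (_ + _); [apply: IH|apply: IH'].
- by rewrite rmorphM /= -!mulrA IH IH'.
Qed.

Lemma spin_proj_form v : spin_proj (spinor_form v) = spinor_form v.
Proof.
rewrite /spinor_form /spin_proj linext_sum; apply: eq_bigr => c _.
rewrite mulrC -/(spin_proj _) spin_proj_segre; congr (_ * _).
by rewrite in_monomialE /spin_proj linextX spin_weight_in.
Qed.

Lemma spin_proj_momenta q : ideal E q -> ideal E (spin_proj q).
Proof.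
have base r c a : ideal E (spin_proj (a * momentum CC (@spinor_index N) r c)).
  have <- : segre (sumgen N (entry r c)) = momentum CC (@spinor_index N) r c.
    by rewrite segre_sumgen entry_rowE entry_colE.
  rewrite mulrC spin_proj_segre segre_sumgen; apply/ideal_mulr/ideal_mem/momentum_in.
move=> [a1 [a2 [a3 [a4 /eqP]]]]; rewrite !subr_eq add0r => /eqP ->.
have proj_add p p' : spin_proj (p + p') = spin_proj p + spin_proj p' by exact: linextD.
by rewrite !proj_add; do !apply: ideal_add => //; apply: base.
Qed.

Lemma spinor_formD v v' : spinor_form (fun c => v c + v' c) = spinor_form v + spinor_form v'.
Proof.
by rewrite /spinor_form -big_split; apply: eq_bigr => c _; rewrite rmorphD mulrDr.
Qed.

Lemma spin_weight_form m : spin_weight m -> exists v, 'X_[m] = spinor_form v.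
Proof.
move=> /forallP wm.
(* Takes as many factors of component [true] as possible, at most [2h]; by the weight condition
   enough factors of component [false] remain to complete an [in_monomial], with balanced
   quotient. *)
pose c : idx := [ffun t => inord (minn n2h (ex m (sigma t) true t))].
have cE t : nat_of_ord (c t) = minn n2h (ex m (sigma t) true t).
  by rewrite ffunE inordK // ltnS geq_minl.
have le : (in_mnm c <= m)%MM.
  apply/mnm_lepP => x; have [t [e ->]] := mxvec_index_ex x.
  have -> : mxvec_index t e = spinor_index (entry_row e, entry_col e, t).
    by rewrite /spinor_index entryK.
  rewrite in_mnmE; case: eqP => // ->; rewrite cE; have /eqP := wm t.
  case: (entry_col e) => [_|]; first exact: geq_minr.
  move: (m _) (m _) (m _) (m _) => i j k l; lia.
have bal : balanced (m - in_mnm c)%MM.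
  apply/forallP => t; rewrite !mnmBE !in_mnmE; have /eqP := wm t.
  case: (sigma t) (cE t) => /= -> H; apply/eqP; move: H => /=;
    move: (m _) (m _) (m _) (m _) => i j k l; rewrite !subn0; lia.
exists (fun c' => if c' == c then lift_mnm (m - in_mnm c)%MM else 0).
rewrite /spinor_form (bigD1 c) //= eqxx big1 => [|c' /negPf ->].
  by rewrite addr0 segre_lift_mnm // in_monomialE -mpolyXD addmC submK.
by rewrite rmorph0 mulr0.
Qed.

Lemma spin_proj_ex q : exists v, spin_proj q = spinor_form v.
Proof.
have form0 : exists v, 0 = spinor_form v.
  by exists (fun=> 0); rewrite /spinor_form big1 // => c _; rewrite rmorph0 mulr0.
elim/mpolyind: q => [|c m q _ _ [v IH]]; first by rewrite /spin_proj linext0.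
rewrite /spin_proj linextD linextZ linextX -/(spin_proj q) IH.
case: ifP => [/spin_weight_form[w ->]|_]; last by exists v; rewrite scaler0 add0r.
exists (fun d => c%:MP * w d + v d); rewrite spinor_formD; congr (_ + _).
rewrite /spinor_form scaler_sumr; apply: eq_bigr => d _.
by rewrite rmorphM /= segreC mulrCA mul_mpolyC.
Qed.

Lemma out_monomial_nz r : (4 <= N)%N -> ~ ideal E (out_monomial r).
Proof.
move=> N4; have pm := prime_momenta (K := CC) N4 (@spinor_index_inj N).
have one := @one_notin CC N _ (@spinor_index N).
apply: (prime_prod pm one) => t _; apply: (prime_mul pm).
  by apply: (prime_exp pm) => //; apply: (spinor_nz (@spinor_index_inj N)).
by apply: (prime_exp pm) => //; apply: (spinor_nz (@spinor_index_inj N)).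
Qed.

End SpinorModule.

(** * Charts *)

Section Charts.
Variable N : nat.
Local Notation P := (Pol N).
Implicit Types (W Y Z : point N -> Prop).

(** [xi] identifies [R[1/f0]] with a polynomial ring localised at [xi f0]. As [xi] is defined on all
    of [R], each point of the affine space yields a point of [X]. Positivity of [n] provides
    hyperplanes. *)
Definition chart (f0 : P) (n : nat) (xi : {rmorphism P -> {mpoly CC[n]}}) : Prop :=
  [/\ (0 < n)%N, forall c, xi c%:MP = c%:MP, forall p, inI p <-> xi p = 0,
      xi f0 != 0 & forall q, exists p k, xi p = q * xi f0 ^+ k].

Lemma inI_inX (p : P) x : inI p -> inX x -> p.@[x] = 0.
Proof.
move=> [q1 [q2 ->]] [X1 X2]; rewrite mevalD !(raddf_sum (meval x)) big1 => [|i _].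
  by rewrite add0r big1 // => i _; rewrite /= mevalM X2 mulr0.
by rewrite /= mevalM X1 mulr0.
Qed.

Lemma closedX_inX Y x : closedX Y -> Y x -> inX x.
Proof. by move=> [S HS] /HS[]. Qed.

Lemma closedX_zero (p : P) : closedX (fun x => inX x /\ p.@[x] = 0).
Proof.
exists (eq p) => x; split=> [[Xx px]|[Xx H]]; first by split=> // _ <-.
by split=> //; apply: H.
Qed.

Lemma irredX_prime W (p q : P) : irredX W -> (forall x, W x -> (p * q).@[x] = 0) ->
  (forall x, W x -> p.@[x] = 0) \/ (forall x, W x -> q.@[x] = 0).
Proof.
move=> [cW [_ irW]] H.
case: (irW _ _ (closedX_zero p) (closedX_zero q)).
- move=> x Wx; have Xx := closedX_inX cW Wx; have /eqP := H x Wx.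
  by rewrite mevalM mulf_eq0 => /orP[]/eqP; [left|right].
- by move=> HW; left => x /HW[].
- by move=> HW; right => x /HW[].
Qed.

Lemma closedX_separate Z W : closedX Z -> (forall x, W x -> inX x) -> psubsetP Z W ->
  exists q : P, (forall x, Z x -> q.@[x] = 0) /\ exists2 x, W x & q.@[x] <> 0.
Proof.
move=> [S HS] WX [_ [x [Wx nZx]]]; apply: NNPP => H; apply: nZx; apply/HS.
split=> [|p Sp]; first exact: WX.
apply: NNPP => px; apply: H; exists p; split; last by exists x.
by move=> y /HS[_]; apply.
Qed.

Section Chart.
Variables (f0 : P) (n : nat) (xi : {rmorphism P -> {mpoly CC[n]}}).
Hypothesis chart_xi : chart f0 xi.

Definition chart_point (y : 'I_n -> CC) : point N := fun i => (xi 'X_i).@[y].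

Lemma chart_pointE p y : p.@[chart_point y] = (xi p).@[y].
Proof.
have [_ xiC _ _ _] := chart_xi.
apply: (mpoly_rmorph_ext (f := meval (chart_point y)) (g := meval y \o xi)) => [c|i] /=.
  by rewrite xiC !mevalC.
by rewrite mevalXU.
Qed.

Lemma chart_point_inX y : inX (chart_point y).
Proof.
have [_ _ xiI _ _] := chart_xi.
have H p : inI p -> p.@[chart_point y] = 0.
  by move/xiI => e; rewrite chart_pointE e meval0.
by split=> [e|t]; apply: H; [apply: inI_sumgen|apply: inI_Qgen].
Qed.

Variable (p : {mpoly CC[n]}).
Hypotheses (pp : prime_elt p) (pf0 : ~ divides p (xi f0)).

(** The closure in [X] of the image of the hypersurface [p = 0]. *)
Definition prime_divisor : point N -> Prop :=
  fun x => inX x /\ forall q, divides p (xi q) -> q.@[x] = 0.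

Lemma prime_divisor_point y : p.@[y] = 0 -> prime_divisor (chart_point y).
Proof.
move=> py; split=> [|q [c e]]; first exact: chart_point_inX.
by rewrite chart_pointE e mevalM py mul0r.
Qed.

Lemma prime_divisor_vanish q :
  (forall x, prime_divisor x -> q.@[x] = 0) -> divides p (xi q).
Proof.
move=> H; apply: hypersurface_nullstellensatz pp _ => y py.
by rewrite -chart_pointE; apply/H/prime_divisor_point.
Qed.

Lemma irred_prime_divisor : irredX prime_divisor.
Proof.
have [p0 pu pP] := pp; split; [|split].
- by exists (fun q => divides p (xi q)).
- apply: NNPP => H; apply: pf0; apply: prime_divisor_vanish => x Dx.
  by case: H; exists x.
move=> Z1 Z2 c1 c2 H12; apply: NNPP => /not_or_and[n1 n2].
have sep Z : closedX Z -> ~ Defs.subsetP prime_divisor Z ->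
    exists q, (forall x, Z x -> q.@[x] = 0) /\ ~ divides p (xi q).
  move=> [S HS] nZ; apply: NNPP => H; apply: nZ => x Dx; apply/HS.
  split=> [|q Sq]; first by case: Dx.
  apply: NNPP => qx; apply: H; exists q; split; first by move=> y /HS[_]; apply.
  by move=> dq; apply: qx; case: Dx => _; apply.
have [q1 [v1 d1]] := sep _ c1 n1; have [q2 [v2 d2]] := sep _ c2 n2.
have : divides p (xi (q1 * q2)).
  apply: prime_divisor_vanish => x /H12[/v1|/v2] e; rewrite mevalM e ?mul0r //.
  by rewrite mulr0.
by rewrite rmorphM => /pP[].
Qed.

(* Krull's principal ideal theorem, elementary since the chart ring is factorial. *)
Lemma prime_divisor_codim Z1 Z2 : irredX Z1 -> irredX Z2 ->
  psubsetP prime_divisor Z1 -> psubsetP Z1 Z2 -> False.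
Proof.
have [_ _ xiI h0 xi_surj] := chart_xi; have [p0 pu pP] := pp.
move=> ir1 ir2 ps1 ps2.
have [c1 _] := ir1; have [c2 _] := ir2.
(* [V] is the prime ideal of [Z1]; it lies strictly between zero, as [q] shows, and the ideal of the
   divisor, as [r] shows. *)
pose V g := forall x, Z1 x -> g.@[x] = 0.
have VI g g' : inI (g - g') -> V g -> V g'.
  move=> Ig Vg x Z1x; have := inI_inX Ig (closedX_inX c1 Z1x).
  by rewrite mevalB (Vg x Z1x) sub0r => /eqP; rewrite oppr_eq0 => /eqP.
have Vdiv g : V g -> divides p (xi g).
  by move=> Vg; apply: prime_divisor_vanish => x Dx; apply: Vg; apply: (proj1 ps1).
have Vprime g g' : V (g * g') -> V g \/ V g' by exact: irredX_prime.
have VMl g g' : V g' -> V (g * g') by move=> Vg' x /Vg' e; rewrite mevalM e mulr0.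
have f0P k : ~ V (f0 ^+ k).
  by move=> /Vdiv; rewrite rmorphXn /= => /(divides_expr pp).
have [q [Vq [x Z2x qx]]] := closedX_separate c1 (fun x => @closedX_inX Z2 x c2) ps2.
have q0 : xi q != 0.
  by apply/eqP => /xiI Iq; apply: qx; apply: (inI_inX Iq); apply: closedX_inX Z2x.
have cD : closedX prime_divisor by case: irred_prime_divisor.
have [r [Dr [x' Z1x' rx']]] := closedX_separate cD (fun x => @closedX_inX Z1 x c1) ps1.
have [pi [a epi]] := xi_surj p.
have Vpi : V pi.
  apply: NNPP => nVpi.
  (* Infinite descent from [q]: if [pi] is not in [V], an element of [V] divided by [p] remains in
     [V] up to powers of [f0], with smaller degree. *)
  suff H m : forall g k c, (msize c < m)%N -> xi g = c * xi f0 ^+ k -> c != 0 -> ~ V g.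
    by apply: (H (msize (xi q)).+1 q 0%N (xi q)); rewrite ?expr0 ?mulr1.
  elim: m => // m IH g k c lt eg c0 Vg.
  have [d ed] : divides p c.
    have := Vdiv _ Vg; rewrite eg => /pP[] // /(divides_expr pp) //.
  have d0 : d != 0 by apply: contraNneq c0 => d0; rewrite ed d0 mulr0.
  have [g' [l eg']] := xi_surj d.
  have Vg' : V g'.
    have Vp : V (pi * g' * f0 ^+ k).
      apply: (VI (f0 ^+ (a + l) * g)); last exact: VMl.
      apply/xiI; rewrite rmorphB !rmorphM /= !rmorphXn /= epi eg eg' ed exprD.
      by apply/eqP; rewrite subr_eq0; apply/eqP; ring.
    by case: (Vprime _ _ Vp) => [/Vprime[]|/f0P].
  apply: (IH g' l d) => //.
  have szp : (1 < msize p)%N.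
    rewrite ltnNge; apply: contra pu => /msize1_polyC e.
    have := p0; rewrite e mpolyC_eq0 => pc0; apply: rmorph_unit.
    by rewrite unitfE.
  move: lt; rewrite ed msizeM //.
  by move: szp; case: (msize p) => [|[|s]] // _;
    rewrite !addSn /= ltnS; apply: leq_ltn_trans; rewrite leq_addl.
(* [r] vanishes on the divisor, so up to a power of [f0] it is a multiple of [pi] and lies in [V],
   against its choice. *)
have [c ec] := prime_divisor_vanish Dr.
have [g [b eg]] := xi_surj c.
have Vr : V (f0 ^+ (a + b) * r).
  apply: (VI (g * pi)); last exact: VMl.
  apply/xiI; rewrite rmorphB !rmorphM /= !rmorphXn /= epi eg ec exprD.
  by apply/eqP; rewrite subr_eq0; apply/eqP; ring.
by case: (Vprime _ _ Vr) => [/f0P|/(_ _ Z1x')].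
Qed.

End Chart.

Section ClearDenominator.
Variables (f0 : P) (n : nat) (xi : {rmorphism P -> {mpoly CC[n]}}).
Hypothesis chart_xi : chart f0 xi.
Variables (Y : point N -> Prop) (S : P -> Prop).
Hypotheses (YS : forall x, Y x <-> inX x /\ forall p, S p -> p.@[x] = 0).
Hypothesis codimY : codim_ge2 Y.

(** If [p] divided all equations of [Y], the divisor of [p] would lie in [Y], and the codimension
    would place a chain of length two above it. *)
Lemma prime_not_dividing p : prime_elt p -> ~ divides p (xi f0) ->
  exists2 s, S s & ~ divides p (xi s).
Proof.
move=> pp pf0; apply: NNPP => H.
have [|Z1 [Z2 [ir1 [ir2 [ps1 ps2]]]]] := codimY (irred_prime_divisor chart_xi pp pf0).
  move=> x [Xx Dx]; apply/YS; split=> // s Ss; apply: Dx; apply: NNPP => ns.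
  by apply: H; exists s.
exact: (prime_divisor_codim chart_xi pp pf0 ir1 ir2 ps1 ps2).
Qed.

Lemma ex_equation_notin : exists2 s, S s & ~ inI s.
Proof.
have [n0 _ xiI h0 _] := chart_xi.
have [y hy] := mpoly_nonroot h0.
(* A hyperplane through a point where [xi f0] is nonzero is a prime not dividing [xi f0]. *)
have [|s Ss ns] := @prime_not_dividing _ (prime_XsubC (Ordinal n0) (y (Ordinal n0))).
  move=> [c e]; move: hy; rewrite e mevalM mevalB mevalXU mevalC subrr mul0r.
  by rewrite eqxx.
by exists s => // /xiI e; apply: ns; rewrite e; apply: divides0.
Qed.

Lemma chart_clear_denominator w u : ~ inI w ->
  (forall s, S s -> exists k a, inI ((s * f0) ^+ k * u - w * a)) ->
  exists k a, inI (f0 ^+ k * u - w * a).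
Proof.
have [_ _ xiI h0 xi_surj] := chart_xi.
move=> nw H; have [deg fac] := mpoly_factorial CC n.
have w0 : xi w != 0 by apply/eqP => /xiI.
have [||k [c ec]] := clear_denominator (h := xi f0) (u := xi u)
   (S := fun s => exists2 g, S g & s = xi g) fac w0.
- by move=> p pp np; have [s Ss ns] := prime_not_dividing pp np; exists (xi s) => //; exists s.
- move=> _ [s Ss ->]; have [k [a /xiI]] := H s Ss.
  rewrite rmorphB !rmorphM /= rmorphXn /= rmorphM => /subr0_eq e.
  by exists k, (xi a).
have [a [l ea]] := xi_surj c; exists (k + l)%N, a.
apply/xiI; rewrite rmorphB !rmorphM /= rmorphXn /= ea exprD mulrA -ec.
by apply/eqP; rewrite subr_eq0; apply/eqP; ring.
Qed.

End ClearDenominator.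
End Charts.

Section EntryMaps.
Variables (N : nat) (R : comNzRingType) (f : {rmorphism CC -> R}).
Variable M : 'M[R]_(N, 4).

Definition entry_map : Pol N -> R := mmap f (mxvec M 0).

HB.instance Definition _ := GRing.RMorphism.on entry_map.

Lemma entry_mapC c : entry_map c%:MP = f c.
Proof. exact: mmapC. Qed.

Lemma entry_map_var t e : entry_map (var t e) = M t e.
Proof. by rewrite /entry_map /var mmapX mmap1U mxvecE. Qed.

End EntryMaps.

Section SolvingForTwo.
Variables (R : comNzRingType) (N : nat) (i j : 'I_N).
Hypothesis ij : i != j.
Variables (a b z : 'I_N -> R).

Definition minor s t := a s * b t - a t * b s.

(* The [x t] with [sum a x = sum b x = 0], in terms of [z t = x t / minor i j] for [t <> i, j]. *)
Definition solved_coord t : R :=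
  if t == i then \sum_(s | (s != i) && (s != j)) minor j s * z s
  else if t == j then \sum_(s | (s != i) && (s != j)) minor s i * z s
  else minor i j * z t.

Lemma solved_coord_sum c : c = a \/ c = b -> \sum_t c t * solved_coord t = 0.
Proof.
move=> Hc; have ji : j != i by rewrite eq_sym.
rewrite (bigD1 i) //= (bigD1 j) //= addrA /solved_coord !eqxx (negPf ji).
rewrite [\sum_(_ | _) c _ * _](eq_bigr (fun t => c t * (minor i j * z t))); last first.
  by move=> t /andP[/negPf -> /negPf ->].
rewrite !mulr_sumr -!big_split /=; apply: big1 => t _.
by case: Hc => ->; rewrite /minor; ring.
Qed.

Lemma minor_relation x k :
  \sum_t a t * x t = 0 -> \sum_t b t * x t = 0 -> \sum_t minor k t * x t = 0.
Proof.
move=> sa sb; rewrite (eq_bigr (fun t => a k * (b t * x t) - b k * (a t * x t))).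
  by rewrite sumrB -!mulr_sumr sa sb !mulr0 subrr.
by move=> t _; rewrite /minor; ring.
Qed.

Lemma solve_coord x :
  \sum_t a t * x t = 0 -> \sum_t b t * x t = 0 ->
  \sum_(s | (s != i) && (s != j)) minor j s * x s = minor i j * x i /\
  \sum_(s | (s != i) && (s != j)) minor s i * x s = minor i j * x j.
Proof.
move=> sa sb; have ji : j != i by rewrite eq_sym.
have mm t : minor t t = 0 by rewrite /minor subrr.
have mC s t : minor s t = - minor t s by rewrite /minor opprB.
split.
  have := minor_relation j sa sb; rewrite (bigD1 i) //= (bigD1 j) //= mm mul0r add0r.
  by rewrite mC mulNr => /eqP; rewrite addrC subr_eq0 => /eqP.
have := minor_relation i sa sb; rewrite (bigD1 i) //= (bigD1 j) //= mm mul0r add0r => /eqP.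
rewrite addrC addr_eq0 => /eqP e; apply: oppr_inj; rewrite -e -sumrN.
by apply: eq_bigr => s _; rewrite mC mulNr opprK.
Qed.

End SolvingForTwo.

Lemma neg_sum_others (V : zmodType) N (c : 'I_N -> V) l :
  \sum_t c t = 0 -> - \sum_(t | t != l) c t = c l.
Proof. by rewrite (bigD1 l) //= => /eqP; rewrite addr_eq0 => /eqP ->. Qed.

(** * An explicit chart where all [a_t] and one minor are invertible *)

Section ExplicitChart.
Variable N : nat.
Hypothesis N4 : (4 <= N)%N.
Local Notation P := (Pol N).
Local Notation X := (@spinor CC N (N * 4) (@spinor_index N)).
Local Notation E := (momenta CC (@spinor_index N)).
Variables i j : 'I_N.
Hypothesis ij : i != j.
Variable l : 'I_N.
Hypothesis li : l != i.

Definition chart_elt : P := \prod_t va t * minor (@va N) (@vb N) i j.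

(* Coordinates of the chart: [a t] and [b t] for [t <> l], and [z t] for [t <> i, j]. *)
Definition coordT : finType :=
  (({t : 'I_N | t != l} + {t : 'I_N | t != l}) + {t : 'I_N | (t != i) && (t != j)})%type.

Local Notation A := {mpoly CC[#|coordT|]}.

Definition coord (x : coordT) : A := 'X_(enum_rank x).

Definition fill (al : 'I_N -> A) t : A :=
  if t == l then - \sum_(s | s != l) al s else al t.

Definition coord_a : 'I_N -> A :=
  fill (fun t => if insub t is Some z then coord (inl (inl z)) else 0).
Definition coord_b : 'I_N -> A :=
  fill (fun t => if insub t is Some z then coord (inl (inr z)) else 0).
Definition coord_z t : A := if insub t is Some z then coord (inr z) else 0.
Definition coord_x : 'I_N -> A := solved_coord i j coord_a coord_b coord_z.

(** Where [a_t] is invertible, [k_t] is the column [(1, x_t)] times the row [(a_t, b_t)], and the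
    four sums become linear conditions on [a], [b] and [x]. Using [z] instead of [x] keeps all
    entries polynomial. *)
Definition chart_mx : 'M[A]_(N, 4) :=
  \matrix_(t, e) ((if entry_row e then coord_x t else 1)
                * (if entry_col e then coord_b t else coord_a t)).

Definition chart_map : P -> A := entry_map (@mpolyC #|coordT| CC) chart_mx.

HB.instance Definition _ := GRing.RMorphism.on chart_map.

Lemma fill_sum al : \sum_t fill al t = 0.
Proof.
rewrite (bigD1 l) //= /fill eqxx [X in _ + X](eq_bigr al); first by rewrite addNr.
by move=> t /negPf ->.
Qed.

Lemma chart_map_abcd t : [/\ chart_map (va t) = coord_a t, chart_map (vb t) = coord_b t,
  chart_map (vc t) = coord_x t * coord_a t & chart_map (vd t) = coord_x t * coord_b t].
Proof.
by split; rewrite /chart_map entry_map_var mxE /entry_row /entry_col /= ?mul1r.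
Qed.

Lemma chart_mapC c : chart_map c%:MP = c%:MP.
Proof. exact: entry_mapC. Qed.

Lemma chart_map_inI p : inI p -> chart_map p = 0.
Proof.
move=> [q1 [q2 ->]]; rewrite rmorphD !rmorph_sum /= big1 => [|e _]; last first.
  rewrite rmorphM /=; suff -> : chart_map (sumgen N e) = 0 by rewrite mulr0.
  rewrite /sumgen rmorph_sum /=.
  rewrite (eq_bigr (fun t => (if entry_row e then coord_x t else 1)
     * (if entry_col e then coord_b t else coord_a t))); last first.
    by move=> t _; rewrite /chart_map entry_map_var mxE.
  case: (entry_row e); last first.
    case: (entry_col e); rewrite (eq_bigr _ (fun _ _ => mul1r _)); exact: fill_sum.
  rewrite (eq_bigr _ (fun _ _ => mulrC _ _)).
  by case: (entry_col e); apply: (solved_coord_sum ij); [right|left].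
rewrite add0r big1 // => t _; rewrite rmorphM /=.
suff -> : chart_map (Qgen t) = 0 by rewrite mulr0.
have [ea eb ec ed] := chart_map_abcd t.
rewrite /Qgen rmorphB (rmorphM _ (va t)) (rmorphM _ (vb t)) /= ea eb ec ed; ring.
Qed.

Lemma coord_a_free (s : {t : 'I_N | t != l}) : coord (inl (inl s)) = coord_a (val s).
Proof. by rewrite /coord_a /fill (negPf (valP s)) valK. Qed.

Lemma coord_b_free (s : {t : 'I_N | t != l}) : coord (inl (inr s)) = coord_b (val s).
Proof. by rewrite /coord_b /fill (negPf (valP s)) valK. Qed.

Lemma coord_z_free (s : {t : 'I_N | (t != i) && (t != j)}) : coord (inr s) = coord_z (val s).
Proof. by rewrite /coord_z valK. Qed.

Lemma chart_map_elt : chart_map chart_elt = \prod_t coord_a t * minor coord_a coord_b i j.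
Proof.
rewrite /chart_elt rmorphM rmorph_prod /minor rmorphB (rmorphM _ (va i)) (rmorphM _ (va j)) /=.
have [-> -> _ _] := chart_map_abcd i; have [-> -> _ _] := chart_map_abcd j.
by congr (_ * _); apply: eq_bigr => t _; have [] := chart_map_abcd t.
Qed.

Lemma chart_map_surj q : exists p k, chart_map p = q * chart_map chart_elt ^+ k.
Proof.
elim/mpoly_alg_ind: q => [c|x|p q [p' [k ep]] [q' [m eq]]|p q [p' [k ep]] [q' [m eq]]].
- by exists c%:MP, 0%N; rewrite expr0 mulr1 /chart_map entry_mapC.
- rewrite -[x]enum_valK -/(coord _); case: (enum_val x) => [[s|s]|s].
  + exists (va (val s)), 0%N; rewrite expr0 mulr1 coord_a_free.
    by have [] := chart_map_abcd (val s).
  + exists (vb (val s)), 0%N; rewrite expr0 mulr1 coord_b_free.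
    by have [] := chart_map_abcd (val s).
  (* The image of [vc] is the minor times [z a]; the other [a_t] complete it to [z] times the chart
     function. *)
  + exists (vc (val s) * \prod_(t | t != val s) va t), 1%N.
    rewrite expr1 chart_map_elt rmorphM rmorph_prod /=.
    have [_ _ -> _] := chart_map_abcd (val s).
    rewrite [\prod_t coord_a t](bigD1 (val s)) //=.
    rewrite (eq_bigr coord_a) => [|t _]; last by have [] := chart_map_abcd t.
    have /andP[/negPf si /negPf sj] := valP s.
    rewrite /coord_x /solved_coord si sj coord_z_free; ring.
- exists (chart_elt ^+ m * p' + chart_elt ^+ k * q'), (k + m)%N.
  by rewrite rmorphD 2!rmorphM /= 2!rmorphXn /= ep eq exprD; ring.
- by exists (p' * q'), (k + m)%N; rewrite rmorphM /= ep eq exprD; ring.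
Qed.

Lemma segre_chart_elt : segre chart_elt = chart_fun CC (@spinor_index N) false false i j.
Proof.
rewrite /chart_elt rmorphM rmorph_prod /minor rmorphB (rmorphM _ (va i)) (rmorphM _ (va j)) /=.
rewrite !segre_var /chart_fun; congr (_ * _); last by rewrite /bracket /entry_row /entry_col /=; ring.
by apply: eq_bigr => t _; rewrite segre_var.
Qed.

Lemma chart_elt_nz : ~ inI chart_elt.
Proof.
rewrite segreP segre_chart_elt.
exact: (chart_fun_nz N4 (@spinor_index_inj N)).
Qed.

Section Point.
Variable y : 'I_(N * 4) -> CC.
Hypotheses (vy : variety E y) (Fy : (segre chart_elt).@[y] != 0).

Let v al t : CC := y (spinor_index (false, al, t)).
Let w be t : CC := y (spinor_index (true, be, t)).
Let ya t := v false t * w false t.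
Let yb t := v false t * w true t.
Let yx t := v true t / v false t.
Let yz t := yx t / minor ya yb i j.

Definition coord_value (k : 'I_#|coordT|) : CC :=
  match enum_val k with
  | inl (inl s) => ya (val s)
  | inl (inr s) => yb (val s)
  | inr s => yz (val s)
  end.

Let coordE x : (coord x).@[coord_value] =
  match x with inl (inl s) => ya (val s) | inl (inr s) => yb (val s) | inr s => yz (val s) end.
Proof. by rewrite /coord mevalXU /coord_value enum_rankK. Qed.

Let segre_evalM (p q : P) : (segre (p * q)).@[y] = (segre p).@[y] * (segre q).@[y].
Proof. by rewrite rmorphM mevalM. Qed.

Let segre_evalB (p q : P) : (segre (p - q)).@[y] = (segre p).@[y] - (segre q).@[y].
Proof. by rewrite rmorphB mevalB. Qed.

Let segre_eval t e : (segre (var t e)).@[y] = v (entry_row e) t * w (entry_col e) t.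
Proof. by rewrite segre_var mevalM !mevalXU. Qed.

Let mom al be : \sum_t v al t * w be t = 0.
Proof.
have := vy (momentum_in CC (@spinor_index N) al be).
rewrite /momentum (raddf_sum (meval y)) /= => e; rewrite -[RHS]e.
by apply: eq_bigr => t _; rewrite mevalM !mevalXU.
Qed.

Let v0 t : v false t != 0.
Proof.
move: Fy; rewrite /chart_elt rmorphM mevalM mulf_eq0 negb_or => /andP[H _].
move: H; rewrite rmorph_prod (rmorph_prod (meval y)) /= => /prodf_neq0/(_ t isT).
by rewrite segre_eval mulf_eq0 negb_or => /andP[].
Qed.

Let D0 : minor ya yb i j != 0.
Proof.
move: Fy; rewrite /chart_elt rmorphM mevalM mulf_eq0 negb_or => /andP[_].
suff -> : (segre (minor (@va N) (@vb N) i j)).@[y] = minor ya yb i j by [].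
have Ea t : (segre (va t)).@[y] = ya t by exact: (segre_eval t 0).
have Eb t : (segre (vb t)).@[y] = yb t by exact: (segre_eval t 1).
rewrite [LHS]segre_evalB; congr (_ - _); rewrite segre_evalM; congr (_ * _);
  [exact: Ea|exact: Eb|exact: Ea|exact: Eb].
Qed.

Let fill_value (c : 'I_N -> CC) al : \sum_t c t = 0 ->
  (forall t, t != l -> (al t).@[coord_value] = c t) ->
  forall t, (fill al t).@[coord_value] = c t.
Proof.
move=> sc H t; rewrite /fill; case: (t =P l) => [->|/eqP]; last exact: H.
rewrite mevalN (raddf_sum (meval coord_value)) /= (eq_bigr c H).
exact: neg_sum_others sc.
Qed.

Let a_value t : (coord_a t).@[coord_value] = ya t.
Proof.
apply: fill_value; first exact: mom.
by move=> s sl; rewrite insubT coordE.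
Qed.

Let b_value t : (coord_b t).@[coord_value] = yb t.
Proof.
apply: fill_value; first exact: mom.
by move=> s sl; rewrite insubT coordE.
Qed.

Let z_value t : (t != i) && (t != j) -> (coord_z t).@[coord_value] = yz t.
Proof. by move=> H; rewrite /coord_z insubT coordE. Qed.

Let minor_value s t : (minor coord_a coord_b s t).@[coord_value] = minor ya yb s t.
Proof. by rewrite /minor mevalB !mevalM !a_value !b_value. Qed.

Let sum_x : \sum_t ya t * yx t = 0 /\ \sum_t yb t * yx t = 0.
Proof.
have H be : \sum_t (v false t * w be t) * yx t = 0.
  rewrite -[RHS](mom true be); apply: eq_bigr => t _; rewrite /yx.
  by have := v0 t => vt; field.
by split; apply: H.
Qed.

Let x_value t : (coord_x t).@[coord_value] = yx t.
Proof.
have ji : j != i by rewrite eq_sym.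
have [sa sb] := sum_x.
have rest (f : 'I_N -> A) (g : 'I_N -> CC) : (forall s, (f s).@[coord_value] = g s) ->
    (\sum_(s | (s != i) && (s != j)) f s * coord_z s).@[coord_value] =
    (\sum_(s | (s != i) && (s != j)) g s * yx s) / minor ya yb i j.
  move=> fg; rewrite (raddf_sum (meval coord_value)) /= mulr_suml; apply: eq_bigr => s sij.
  by rewrite mevalM fg z_value // /yz mulrA.
have [si sj] := solve_coord ij sa sb.
rewrite /coord_x /solved_coord; case: (t =P i) => [->|/eqP ti].
  rewrite (rest _ (minor ya yb j)) => [|s]; last exact: minor_value.
  by rewrite si mulrAC divff // mul1r.
case: (t =P j) => [->|/eqP tj].
  rewrite (rest _ (fun s => minor ya yb s i)) => [|s]; last exact: minor_value.
  by rewrite sj mulrAC divff // mul1r.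
by rewrite mevalM minor_value z_value ?ti // /yz mulrC mulfVK.
Qed.

(** Each spinor solution with nonzero chart function comes from the chart, [x_t] being the ratio of
    the components of [v_t]. *)
Lemma chart_map_value p : (chart_map p).@[coord_value] = (segre p).@[y].
Proof.
apply: (mpoly_rmorph_ext (f := meval coord_value \o chart_map) (g := meval y \o @segre N)).
  by move=> c /=; rewrite segreC [chart_map _]chart_mapC !mevalC.
move=> x /=; have [t [e ->]] := mxvec_index_ex x; rewrite -/(var t e) segre_eval.
rewrite /chart_map entry_map_var mxE mevalM.
case: (entry_col e); case: (entry_row e);
  rewrite ?x_value ?a_value ?b_value ?meval1 ?mul1r // /ya /yb /yx mulrA mulfVK //.
Qed.

End Point.

(** The image of [p] vanishes at all spinor solutions where the chart function is nonzero, hence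
    lies in [E], and [segreP] descends this to [I_N]. *)
Lemma chart_map_inI_inv p : chart_map p = 0 -> inI p.
Proof.
move=> p0; apply/segreP.
have nF : ~ ideal E (segre chart_elt) by rewrite -segreP; apply: chart_elt_nz.
apply: (momenta_vanish_away N4 (@spinor_index_inj N) nF) => y vy Fy.
by rewrite -(chart_map_value vy Fy) p0 meval0.
Qed.

Lemma coordT_card : (0 < #|coordT|)%N.
Proof.
have il : i != l by rewrite eq_sym.
by apply/card_gt0P; exists (inl (inl (exist _ i il))).
Qed.

Lemma explicit_chart : chart chart_elt chart_map.
Proof.
split=> [|c|p||]; first exact: coordT_card.
- exact: chart_mapC.
- by split; [apply: chart_map_inI|apply: chart_map_inI_inv].
- by apply/eqP => /chart_map_inI_inv/chart_elt_nz.
- exact: chart_map_surj.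
Qed.

End ExplicitChart.

Lemma chart_comp N (f0 : Pol N) n (xi : {rmorphism Pol N -> {mpoly CC[n]}})
    (kappa : {rmorphism Pol N -> Pol N}) :
  (forall c, kappa c%:MP = c%:MP) -> involutive kappa ->
  (forall p, inI p -> inI (kappa p)) -> chart f0 xi -> chart (kappa f0) (xi \o kappa).
Proof.
move=> kC kK kI [n0 xiC xiI h0 xi_surj]; split=> [//|c|p||q] /=.
- by rewrite kC xiC.
- by split=> [/kI/xiI //|/xiI/kI]; rewrite kK.
- by rewrite kK.
- by have [p [k e]] := xi_surj q; exists (kappa p), k; rewrite !kK.
Qed.

(** * The second chart, by exchanging [a] and [d] *)

Section SwappedChart.
Variable N : nat.
Local Notation P := (Pol N).

(* The transposition a <-> d. *)
Definition swap_entry (e : 'I_4) : 'I_4 := entry (~~ entry_col e) (~~ entry_row e).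

Definition swap : P -> P :=
  entry_map (@mpolyC (N * 4) CC) (\matrix_(t, e) var t (swap_entry e)).

HB.instance Definition _ := GRing.RMorphism.on swap.

Lemma swap_entryK : involutive swap_entry.
Proof. by move=> e; rewrite /swap_entry entry_rowE entry_colE !negbK entryK. Qed.

Lemma swap_var t e : swap (var t e) = var t (swap_entry e).
Proof. by rewrite /swap entry_map_var mxE. Qed.

Lemma swapC c : swap c%:MP = c%:MP.
Proof. exact: entry_mapC. Qed.

Lemma swapK : involutive swap.
Proof.
apply: (mpoly_rmorph_ext (f := swap \o swap) (g := idfun)) => [c|x] /=.
  by rewrite !swapC.
have [t [e ->]] := mxvec_index_ex x.
by rewrite -/(var t e) !swap_var swap_entryK.
Qed.

Lemma swap_abcd t : [/\ swap (va t) = vd t, swap (vb t) = vb t,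
  swap (vc t) = vc t & swap (vd t) = va t].
Proof.
by split; rewrite swap_var; congr (var t _); apply: val_inj; rewrite /= inordK.
Qed.

Lemma swap_inI p : inI p -> inI (swap p).
Proof.
move=> [q1 [q2 ->]]; rewrite rmorphD !rmorph_sum /=; apply: inI_add.
  apply: (big_ind (@inI N)) => [||e _]; [exact: inI_zero|exact: inI_add|].
  rewrite rmorphM /=; apply: inI_mul.
  have -> : swap (sumgen N e) = sumgen N (swap_entry e).
    by rewrite rmorph_sum; apply: eq_bigr => t _; exact: swap_var.
  exact: inI_sumgen.
apply: (big_ind (@inI N)) => [||t _]; [exact: inI_zero|exact: inI_add|].
rewrite rmorphM /=; apply: inI_mul.
have [ea eb ec ed] := swap_abcd t.
have -> : swap (Qgen t) = Qgen t.
  rewrite {1}/Qgen rmorphB (rmorphM _ (va t)) (rmorphM _ (vb t)) /= ea eb ec ed.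
  by rewrite mulrC.
exact: inI_Qgen.
Qed.

(** The minor of [d, b] factors through the bracket of [v] with the opposite orientation, whence the
    order [j i]. *)
Lemma swap_chart_elt i j :
  segre (swap (chart_elt i j)) = chart_fun CC (@spinor_index N) true true j i.
Proof.
have -> : swap (chart_elt i j) = \prod_t vd t * minor (@vd N) (@vb N) i j.
  rewrite /chart_elt rmorphM rmorph_prod; congr (_ * _).
    by apply: eq_bigr => t _; have [] := swap_abcd t.
  rewrite /minor rmorphB (rmorphM _ (va i)) (rmorphM _ (va j)) /=.
  by have [-> -> _ _] := swap_abcd i; have [-> -> _ _] := swap_abcd j.
rewrite rmorphM rmorph_prod /chart_fun; congr (_ * _).
  by apply: eq_bigr => t _ /=; have [_ _ _ ->] := segre_abcd t.
rewrite /minor rmorphB (rmorphM _ (vd i)) (rmorphM _ (vd j)) /=.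
have [_ -> _ ->] := segre_abcd i; have [_ -> _ ->] := segre_abcd j.
by rewrite /bracket /=; ring.
Qed.

Lemma ex_charts (i j : 'I_N) : (4 <= N)%N -> i != j ->
  (exists n (xi : {rmorphism P -> {mpoly CC[n]}}), chart (chart_elt i j) xi) /\
  (exists n (xi : {rmorphism P -> {mpoly CC[n]}}), chart (swap (chart_elt j i)) xi).
Proof.
move=> N4 ij; have ji : j != i by rewrite eq_sym.
have [l] := @fresh_index N N4 [:: i; j] isT.
rewrite !inE negb_or => /andP[li lj]; split.
  exists #|coordT i j l|, (@chart_map N i j l).
  exact: (explicit_chart N4 ij li).
exists #|coordT j i l|, (@chart_map N j i l \o swap).
exact: (chart_comp swapC swapK swap_inI (explicit_chart N4 ji lj)).
Qed.

End SwappedChart.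

(** * Extension of sections *)

Section Extension.
Variables (N n2h : nat) (sigma : 'I_N -> bool).
Hypothesis N4 : (4 <= N)%N.
Variables (Y : point N -> Prop) (S : Pol N -> Prop).
Hypotheses (YS : forall x, Y x <-> inX x /\ forall p, S p -> p.@[x] = 0).
Hypothesis codimY : codim_ge2 Y.

Local Notation P := (Pol N).
Local Notation E := (momenta CC (@spinor_index N)).
Local Notation X := (@spinor CC N (N * 4) (@spinor_index N)).
Local Notation U := (fun x => inX x /\ ~ Y x).
Local Notation form := (@spinor_form N n2h sigma).
Local Notation segre := (@segre N).

Let pE : prime_ideal E := prime_momenta (K := CC) N4 (@spinor_index_inj N).
Let oneE : ~ ideal E 1 := @one_notin CC N _ (@spinor_index N).

Lemma segre_exp_nz (f : P) k : ~ inI f -> ~ ideal E (segre f ^+ k).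
Proof. by rewrite segreP => nf; apply: (prime_exp pE). Qed.

Lemma Dopen_equation f g : S f -> Defs.subsetP (Dopen (f * g)) U.
Proof.
move=> Sf x [Xx fx]; split=> // /YS[_ H]; apply: fx.
by rewrite mevalM (H _ Sf) mul0r.
Qed.

Lemma Dopen_mull (f g : P) : Defs.subsetP (Dopen (f * g)) (Dopen f).
Proof. by move=> x [Xx fx]; split=> // e; apply: fx; rewrite mevalM e mul0r. Qed.

Lemma Dopen_mulr (f g : P) : Defs.subsetP (Dopen (f * g)) (Dopen g).
Proof. by rewrite mulrC; apply: Dopen_mull. Qed.

Lemma form_out r (v : Defs.idx N n2h -> P) : segre (Kv sigma v r) = out_monomial sigma r * form v.
Proof. exact: segre_Kv. Qed.

Variable s : P -> (Defs.idx N n2h -> P) * nat.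
Hypothesis sec_s : is_section sigma U s.

Let num f := form (s f).1.
Let den f := segre f ^+ (s f).2.

Lemma section_restrict f g : Defs.subsetP (Dopen f) U -> Defs.subsetP (Dopen g) U ->
  Defs.subsetP (Dopen g) (Dopen f) -> ~ inI g -> ideal E (den f * num g - den g * num f).
Proof.
move=> fU gU gf ng; have [j Hj] := sec_s fU gU gf.
pose r : Defs.idx N n2h := [ffun=> ord0].
have := Hj r; rewrite segreP => H.
apply: (prime_cancel pE (@out_monomial_nz N n2h sigma r N4)).
apply: (prime_cancel pE (segre_exp_nz (k := j) ng)).
have -> : segre g ^+ j * (out_monomial sigma r * (den f * num g - den g * num f)) =
  segre (g ^+ j * (f ^+ (s f).2 * Kv sigma (s g).1 r - g ^+ (s g).2 * Kv sigma (s f).1 r)).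
  rewrite rmorphM rmorphB (rmorphM _ (f ^+ _)) (rmorphM _ (g ^+ (s g).2)) /= !rmorphXn /= !form_out.
  have aux (a b c d x y : P) : a * (b * (c * x - d * y)) = a * (c * (b * x) - d * (b * y)) by ring.
  exact: aux.
exact: H.
Qed.

(** Both values are compared on the basic open set of [f * g], so the section is one fraction,
    independent of [f]. *)
Lemma section_cross f g : Defs.subsetP (Dopen f) U -> Defs.subsetP (Dopen g) U ->
  ~ inI f -> ~ inI g -> ideal E (den f * num g - den g * num f).
Proof.
move=> fU gU nf ng; pose h := f * g.
have nh : ~ inI h.
  rewrite /h segreP rmorphM; apply: (prime_mul pE); [by move/segreP: nf|by move/segreP: ng].
have hU : Defs.subsetP (Dopen h) U by move=> x /Dopen_mull/fU.
have Hf := section_restrict fU hU (@Dopen_mull f g) nh.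
have Hg := section_restrict gU hU (@Dopen_mulr f g) nh.
apply: (prime_cancel pE (segre_exp_nz (k := (s h).2) nh)); rewrite -/(den h).
have -> : den h * (den f * num g - den g * num f) =
  den g * (den f * num h - den h * num f) - den f * (den g * num h - den h * num g).
  have aux (a b c x y z : P) : c * (a * y - b * x) = b * (a * z - c * x) - a * (b * z - c * y).
    by ring.
  exact: aux.
by apply: ideal_subr; apply: ideal_mull.
Qed.

Section Base.
Variable f1 : P.
Hypotheses (Sf1 : S f1) (nf1 : ~ inI f1).

Let f1U : Defs.subsetP (Dopen f1) U.
Proof. by move=> x; rewrite -[f1]mulr1; apply: Dopen_equation. Qed.

(* The section, as the fraction [num f1 / den f1], has no pole away from [f0]. *)
Lemma chart_extension f0 n (xi : {rmorphism P -> {mpoly CC[n]}})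
    (r : Defs.idx N n2h) C m : chart f0 xi ->
  out_monomial sigma r * C = segre f0 ^+ m ->
  exists k p, ideal E (segre f0 ^+ k * num f1 - den f1 * p).
Proof.
move=> ch eC.
have nw : ~ inI (f1 ^+ (s f1).2) by rewrite segreP rmorphXn; apply: segre_exp_nz.
(* The chart applies to elements of [R], so [num f1] is first multiplied by [out_monomial sigma r],
   which gives the coordinate [r] of [Kv]; later [C] turns this factor into a power of [f0]. *)
have [|k [a Ha]] := chart_clear_denominator ch YS codimY (u := Kv sigma (s f1).1 r) nw.
  move=> t St; have [Ih|nh] := classic (inI (t * f0)).
    exists 1%N, 0; rewrite expr1 mulr0 subr0 mulrC; exact: inI_mul.
  have hU : Defs.subsetP (Dopen (t * f0)) U by exact: Dopen_equation.
  have H := section_cross hU f1U nh nf1.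
  exists (s (t * f0)).2, (Kv sigma (s (t * f0)).1 r); rewrite segreP.
  rewrite rmorphB (rmorphM _ ((t * f0) ^+ _)) (rmorphM _ (f1 ^+ _)) /= !rmorphXn /= !form_out.
  move: (ideal_mull (out_monomial sigma r) H); rewrite /den /num.
  have aux (a b c x y : P) : a * (b * x - c * y) = b * (a * x) - c * (a * y) by ring.
  by rewrite aux.
exists (k + m)%N, (segre a * C).
move: Ha; rewrite segreP rmorphB (rmorphM _ (f0 ^+ _)) (rmorphM _ (f1 ^+ _)) /=.
rewrite !rmorphXn /= !form_out => /(ideal_mulr C) I.
have aux (a' b c d x y : P) : (a' * (d * x) - b * y) * c = a' * (d * c) * x - b * (y * c) by ring.
have e : (segre f0 ^+ k * (out_monomial sigma r * num f1) - den f1 * segre a) * C =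
    segre f0 ^+ (k + m) * num f1 - den f1 * (segre a * C).
  by rewrite exprD -eC; exact: aux.
by rewrite -e.
Qed.

Lemma section_extends_base : exists v,
  ideal E (num f1 - den f1 * form v).
Proof.
have [i _] := @fresh_index N N4 [::] isT; have [j] := @fresh_index N N4 [:: i] isT.
rewrite inE eq_sym => ij.
have [[n [xi ch]] [n' [xi' ch']]] := ex_charts N4 ij.
(* The extreme indices, 0 or [2h] throughout, give pure powers of one component, so [out_monomial]
   divides a power of the chart function; this supplies [C]. *)
have base c : exists (r : Defs.idx N n2h) (d : Defs.idx N n2h),
    out_monomial sigma r * in_monomial sigma d =
    \prod_t ((X false c t * X true c t) ^+ n2h).
  pose k : 'I_n2h.+1 := if c then ord_max else ord0.
  have sk b t : spin_monomial b t k = X b c t ^+ n2h.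
    by rewrite /spin_monomial /k; case: (c); rewrite /= ?subnn ?subn0 expr0 ?mul1r ?mulr1.
  exists [ffun=> k], [ffun=> k]; rewrite /out_monomial /in_monomial -big_split.
  apply: eq_bigr => t _; rewrite /= [RHS]exprMn !ffunE !sk.
  by case: (sigma t); [reflexivity|exact: mulrC].
have ext f0 m (z : {rmorphism P -> {mpoly CC[m]}}) b c : chart f0 z ->
    segre f0 = chart_fun CC (@spinor_index N) b c i j ->
    exists k p, ideal E (chart_fun CC (@spinor_index N) b c i j ^+ k * num f1 - den f1 * p).
  move=> chz ef; have [r [d erd]] := base c; rewrite -ef.
  apply: (@chart_extension f0 m z r (in_monomial sigma d * (X b c i * X b c j
    * @bracket CC N _ (@spinor_index N) (~~ b) i j) ^+ n2h) n2h chz).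
  rewrite ef /chart_fun [RHS]exprMn -prodrXl -erd; exact: mulrA.
have [k [p0 Ip0]] := ext _ _ _ false false ch (segre_chart_elt _ _).
have [l [p1 Ip1]] := ext _ _ _ true true ch' (swap_chart_elt _ _).
have nd : ~ ideal E (den f1) := segre_exp_nz nf1.
have reg := @regular_charts CC N (N * 4) N4 (@spinor_index N) (@spinor_index_inj N) i j k l ij.
have nF : ~ ideal E (chart_fun CC (@spinor_index N) false false i j ^+ k).
  apply: (prime_exp pE oneE).
  exact: (@chart_fun_nz CC N (N * 4) N4 (@spinor_index N) (@spinor_index_inj N) false false i j ij).
move: (chart_fun CC (@spinor_index N) false false i j ^+ k) reg Ip0 nF => F.
move: (chart_fun CC (@spinor_index N) true true i j ^+ l) Ip1 => F' Ip1 reg Ip0 nF.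
have segD : exists h, segre h = den f1 by exists (f1 ^+ (s f1).2); rewrite rmorphXn.
have pg : spin_proj n2h sigma (num f1) = num f1 by exact: spin_proj_form.
move: (num f1) (den f1) nd segD pg Ip0 Ip1 => g D nd [h eh] pg Ip0 Ip1.
(* Modulo [E], [F * g = D * p0] and [F' * g = D * p1] give [F' * p0 = F * p1], so [F] divides [p0]
   by regularity, and then [g = D * p]. *)
have [|p Ip] := reg p0.
  exists p1; have aux : D * (F' * p0 - p1 * F) = F * (F' * g - D * p1) - F' * (F * g - D * p0).
    by ring.
  by apply: (prime_cancel pE nd); rewrite aux; apply: ideal_subr; apply: ideal_mull.
have Ig : ideal E (g - D * p).
  have aux : F * (g - D * p) = (F * g - D * p0) + D * (p0 - p * F) by ring.
  apply: (prime_cancel pE nF); rewrite aux; apply: ideal_add => //; exact: ideal_mull.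
(* [p] may have components of other weights. Since [D] comes from [R] and [g] has the weight of [M],
   projecting [g = D * p] replaces [p] by an element of [M]. *)
have [v ev] := spin_proj_ex n2h sigma p; exists v.
have := spin_proj_momenta n2h sigma Ig.
have -> : g - D * p = g + (-1) *: (segre h * p) by rewrite eh scaleN1r.
by rewrite [spin_proj _ _ _]linextD linextZ [linext _ g]pg [linext _ _]spin_proj_segre ev eh scaleN1r.
Qed.

Lemma section_extends : exists v, eq_section sigma U s (restr v).
Proof.
have [v Iv] := section_extends_base; exists v => f fU.
(* For [f] in [I_N] the open set is empty, and one factor [f] kills the difference. *)
have [If|nf] := classic (inI f).
  by exists 1%N => r; rewrite expr1 mulrC; apply: inI_mul.
have H := section_cross f1U fU nf1 nf.
have nd : ~ ideal E (den f1) := segre_exp_nz nf1.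
have I : ideal E (num f - den f * form v).
  apply: (prime_cancel pE nd).
  have aux (a b c x y : P) : a * (x - b * c) = (a * x - b * y) + b * (y - a * c) by ring.
  by rewrite (aux _ _ _ _ (num f1)); apply: ideal_add => //; apply: ideal_mull.
exists 0%N => r; rewrite /= !expr0 !mul1r segreP.
rewrite rmorphB (rmorphM _ (f ^+ _)) /= rmorphXn /= !form_out.
move: (ideal_mull (out_monomial sigma r) I).
have aux (a b c d : P) : a * (b - c * d) = a * b - c * (a * d) by ring.
by rewrite aux.
Qed.

End Base.
End Extension.

(* n2h = 2h (h >= 0 half-integer); sigma t = true means sigma_t = + *)
Theorem mainTheorem17 (N : nat) (n2h : nat) (sigma : 'I_N -> bool) :
  (4 <= N)%N ->
  forall Y : point N -> Prop,
    closedX Y -> codim_ge2 Y ->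
    restr_iso n2h sigma (fun x => inX x /\ ~ Y x).
Proof.
move=> N4 Y [S YS] codimY.
have [i _] := @fresh_index N N4 [::] isT; have [j] := @fresh_index N N4 [:: i] isT.
rewrite inE eq_sym => ij; have [[n [xi ch]] _] := ex_charts N4 ij.
have [f Sf nf] := ex_equation_notin ch YS codimY.
split=> [v v' H r|s sec_s].
  (* One basic open set suffices for injectivity, since powers of [f] cancel in the domain [R]. *)
  have [|j' /(_ r)] := H f; first by move=> x; rewrite -[f]mulr1; apply: Dopen_equation.
  rewrite /= !expr0 !mul1r !segreP rmorphM rmorphXn.
  apply: (prime_cancel (prime_momenta (K := CC) N4 (@spinor_index_inj N))).
  exact: segre_exp_nz.
exact: (section_extends N4 YS codimY sec_s Sf nf).
Qed.
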